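(* Let $X$ be a real Banach space, let $C\subseteq X$ be nonempty and convex, and let $K:C\rightrightarrows C$ be a compact and lower semicontinuous set-valued map with nonempty values in $\mathcal{D}(X)$ and such that $\operatorname{fix} K$ is closed. Assume that $T:C\rightrightarrows X^*$ is norm-to-weak$^*$ upper semicontinuous with nonempty weak$^*$ compact convex values. Then the generalized quasivariational inequality $GQVI(T,K)$ has a solution, that is, there exist $x\in K(x)$ and $x^*\in T(x)$ such that $$\langle x^*,y-x\rangle\ge 0,\qquad\forall y\in K(x).$$
   Context: $X$ is a real Banach space equipped with the norm topology, $X^*$ is its topological dual equipped with the weak$^*$ topology, and $\langle\cdot,\cdot\rangle$ is the duality pairing between $X^*$ and $X$. For $C\subseteq X$ and $K:C\rightrightarrows C$: $K$ is lower semicontinuous if for every open set $\Omega$ the set $\{x\in C:K(x)\cap\Omega\neq\emptyset\}$ is open in $C$; $K$ is compact if $K(C)=\bigcup_{x\in C}K(x)$ is contained in a compact subset of $C$; $\operatorname{fix}K=\{x\in C:x\in K(x)\}$ is the set of fixed points of $K$. $T:C\rightrightarrows X^*$ is norm-to-weak$^*$ upper semicontinuous if for every $x\in C$ and every weak$^*$ open set $\Omega\subseteq X^*$ with $T(x)\subseteq\Omega$ there exists a norm neighbourhood $U_x$ of $x$ in $C$ such that $T(x')\subseteq\Omega$ for all $x'\in U_x$. The class $\mathcal{D}(X)$: for a convex set $D\subseteq X$, a convex set $S\subseteq D$ is a face of $D$ if $x_1,x_2\in D$, $t\in(0,1)$ and $tx_1+(1-t)x_2\in S$ imply $x_1,x_2\in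 S$. Let $\mathcal{F}_D$ be the (possibly empty) collection of all proper closed faces of the closure $\operatorname{cl}D$ (proper meaning different from $\operatorname{cl}D$). The set of inside points of $D$ is $I(D)=D\setminus\bigcup_{S\in\mathcal{F}_D}S$. Then $$\mathcal{D}(X)=\{D\subseteq X: D\text{ is convex and } I(\operatorname{cl}D)\subseteq D\}.$$ *)

(* Defs.v *)
From HB Require Import structures.
From mathcomp Require Import all_boot all_order all_algebra.
From mathcomp Require Import all_classical all_reals all_analysis.

Set Implicit Arguments.
Unset Strict Implicit.
Unset Printing Implicit Defensive.

Import Order.TTheory GRing.Theory Num.Theory.
Import numFieldNormedType.Exports.

Local Open Scope classical_set_scope.
Local Open Scope ring_scope.

Section TopologicalDual.
Context {R : realType} {X : normedModType R}.

Definition in_dual : {pred X -> R^o} :=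
  [pred f | `[< linear f /\ continuous f >] ].

Lemma in_dualP (f : X -> R^o) :
  reflect (linear f /\ continuous f) (f \in in_dual).
Proof. by rewrite inE; exact: asboolP. Qed.

Fact in_dual_submod_closed : submod_closed in_dual.
Proof.
split.
  apply/in_dualP; split; first by move=> a x y /=; rewrite /0/= scaler0 addr0.
  by move=> x; exact: cvg_cst.
move=> a f g /in_dualP[lf cf] /in_dualP[lg cg]; apply/in_dualP; split.
  move=> b x y; rewrite !fctE lf lg.
  by rewrite !scalerDr !scalerA [b * a]mulrC addrACA.
by move=> x; apply: cvgD; [apply: cvgZr; exact: cf | exact: cg].
Qed.

HB.instance Definition _ :=
  GRing.isSubmodClosed.Build R (X -> R^o) in_dual in_dual_submod_closed.

End TopologicalDual.

Record weak_dual (R : realType) (X : normedModType R) : Type :=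
  WeakDual { dual_val : X -> R^o ; dual_valP : dual_val \in in_dual }.

Definition pairing (R : realType) (X : normedModType R)
  (f : weak_dual X) (x : X) : R := dual_val f x.

Section WeakDualStructures.
Context {R : realType} {X : normedModType R}.

HB.instance Definition _ := [isSub for @dual_val R X].
HB.instance Definition _ := [Choice of weak_dual X by <:].
HB.instance Definition _ := [SubChoice_isSubLmodule of weak_dual X by <:].

(* [{ptws X -> R^o}] is [X -> R^o] with the product topology, so this is the
   coarsest topology making every evaluation [pairing ^~ x] continuous. *)
HB.instance Definition _ := Topological.copy (weak_dual X)
  (initial_topology (@dual_val R X : weak_dual X -> {ptws X -> R^o})).

End WeakDualStructures.

Section Faces.
Context {R : realType} {X : normedModType R}.
Implicit Types D S : set X.

Definition face D S : Prop :=
  [/\ convex_set (M := X) S, S `<=` D &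
      forall (x1 x2 : X) (t : R), D x1 -> D x2 -> 0 < t -> t < 1 ->
        S (t *: x1 + (1 - t) *: x2) -> S x1 /\ S x2].

Definition proper_closed_faces D : set (set X) :=
  [set S | [/\ face (closure D) S, closed S & S <> closure D]].

Definition inside_points D : set X :=
  D `\` \bigcup_(S in proper_closed_faces D) S.

Definition class_D : set (set X) :=
  [set D | convex_set (M := X) D /\ inside_points (closure D) `<=` D].

End Faces.

(* A set-valued map [C => Y] is represented by a function on the whole of [X]
   whose values outside [C] are irrelevant: the notions below only use its
   values on [C]. *)
Section SetValuedMaps.
Context {X : topologicalType}.
Implicit Types C : set X.

Definition fixpoints C (K : X -> set X) : set X := [set x | C x /\ K x x].

Definition lsc_on (Y : topologicalType) C (K : X -> set Y) : Prop :=
  forall W : set Y, open W ->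
    open ([set x | C x /\ K x `&` W !=set0] : set (subspace C)).

Definition usc_on (Y : topologicalType) C (T : X -> set Y) : Prop :=
  forall x, C x -> forall W : set Y, open W -> T x `<=` W ->
    \forall x' \near within C (nbhs x), T x' `<=` W.

Definition compact_map C (K : X -> set X) : Prop :=
  exists H : set X,
    [/\ compact H, H `<=` C & \bigcup_(x in C) K x `<=` H].

End SetValuedMaps.

(* Main.v *)
(** Suppose there is no solution, and let [P x] be the set of the [y] such that
    [pairing f (y - x) < 0] for every [f] in [T x]. For [x] fixed by [K], a
    minimax argument makes [K x `&` P x] nonempty, and the graph of [P] is open
    because [T], being upper semicontinuous with weak* compact values, is locally
    bounded (Banach-Steinhaus). As [fix K] is closed, the map equal to
    [K `&` P] on [fix K] and to [K] elsewhere is lower semicontinuous, with values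
    again in [class_D]. By Michael's selection theorem it has a continuous
    selection, which by Schauder's theorem has a fixed point [x]; then [P x x],
    which is absurd. The combinatorial input of Schauder's theorem is Scarf's
    lemma on dominant sets for several linear orders. *)

(* The values of the modified map need not be closed, so a selection theorem only reaches their
   closures. [class_D] repairs this: averaging a dense sequence of selections with weights
   [1 / 2 ^+ n.+1] lands in the inside points of the closed values, and these belong to the values
   themselves. The cut by [P x] preserves [class_D] because [P x] is open and convex and each point
   outside it is strictly separated from it by a functional of [T x]. A second obstacle is that
   [pairing] need not be jointly continuous for the weak* and norm topologies; the local norm bound
   on [T] takes the place of joint continuity. [C] is not assumed closed: limits of points are taken
   in the compact set [H] inside [C]. Compactness of [H] also lets finite nets supply the partitions
   of unity. *)
From HB Require Import structures.
Require Import Defs.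
From mathcomp Require Import all_boot.
From mathcomp Require Import zify.
Set Implicit Arguments.
Unset Strict Implicit.
Unset Printing Implicit Defensive.

(** * Scarf's lemma and a Sperner lemma on grids *)

Section Dominance.
Context (P I : finType) (r : I -> P -> nat) (c : P -> I).
Implicit Types (s t : {set P}) (i k : I) (x y z : P).

Definition dominant s :=
  [forall y, exists i, [forall x in s, r i y <= r i x]].

(** No order other than [i] can place such a [y] below all of [t]. *)
Definition exceeds t i y := [forall (k | k != i), [exists x in t, r k x < r k y]].

Definition top_exceeds t i y :=
  exceeds t i y && [forall (z | exceeds t i z), r i z <= r i y].

Lemma dominantP s :
  reflect (forall y, exists i, forall x, x \in s -> r i y <= r i x) (dominant s).
Proof.
apply: (iffP forallP) => H y.
  by have /existsP[i /forall_inP Hi] := H y; exists i.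
by have [i Hi] := H y; apply/existsP; exists i; apply/forall_inP.
Qed.

Lemma dominant_sub s t : s \subset t -> dominant t -> dominant s.
Proof.
move=> /subsetP st /dominantP dt; apply/dominantP => y.
by have [i Hi] := dt y; exists i => x /st /Hi.
Qed.

Lemma exceedsP t i y :
  reflect (forall k, k != i -> exists2 x, x \in t & r k x < r k y)
          (exceeds t i y).
Proof.
apply: (iffP forall_inP) => H k /H; first by move/exists_inP.
by move=> H'; apply/exists_inP.
Qed.

Lemma top_exceedsP t i y :
  reflect (exceeds t i y /\ forall z, exceeds t i z -> r i z <= r i y)
          (top_exceeds t i y).
Proof. by apply: (iffP andP) => -[? /forall_inP]. Qed.

Hypothesis r_inj : forall i, injective (r i).

Lemma card_top_exceeds t i : (exists y, exceeds t i y) ->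
  #|[set y | top_exceeds t i y]| = 1.
Proof.
move=> [y0 y0P]; apply/eqP/cards1P.
case: (arg_maxnP (r i) y0P) => y yP ymax; exists y.
have {}ymax z : exceeds t i z -> r i z <= r i y by apply: ymax.
apply/setP => z; rewrite !inE; apply/idP/eqP => [/top_exceedsP[zP zmax]|->].
  by apply: (r_inj (i := i)); apply/eqP; rewrite eqn_leq ymax// zmax.
exact/top_exceedsP.
Qed.

(* A dominant set with one element fewer than there are orders has exactly one
   element which is the minimum for two orders [i] and [j]; a point extends it
   to a dominant set iff it is the greatest point exceeding it off [i], or off
   [j]. *)
Lemma dominant_extensions t : dominant t -> t != set0 -> #|t|.+1 = #|I| ->
  exists i j, [/\ i != j,
    forall y, (y \notin t) && dominant (y |: t)
              = top_exceeds t i y || top_exceeds t j y &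
    forall y, ~~ (top_exceeds t i y && top_exceeds t j y)].
Proof.
move=> /dominantP dt /set0Pn[x0 x0t] cardt.
(* Dominance at a point of [t] makes it the minimum of [t] for some order, so [m] maps the orders
   onto [t]. With one order more than points, exactly one pair of orders shares its minimum, and [m]
   becomes a bijection once either of them is dropped. *)
pose m i := [arg min_(x < x0 in t) r i x].
have mP i : m i \in t /\ forall x, x \in t -> r i (m i) <= r i x.
  by rewrite /m; case: arg_minnP.
have m_eq i x : x \in t -> (forall y, y \in t -> r i x <= r i y) -> m i = x.
  move=> xt xmin; have [mt mmin] := mP i.
  by apply: (r_inj (i := i)); apply/eqP; rewrite eqn_leq mmin// xmin.
have m_surj y : y \in t -> exists k, m k = y.
  by move=> yt; have [k Hk] := dt y; exists k; apply: m_eq.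
have im_t (A : {set I}) : (forall k, exists2 l, l \in A & m l = m k) -> m @: A = t.
  move=> HA; apply/setP => y; apply/imsetP/idP => [[k _ ->]|yt].
    by have [] := mP k.
  by have [k <-] := m_surj _ yt; have [l lA lk] := HA k; exists l.
have [i [j [ij mij]]] : exists i j, i != j /\ m i = m j.
  have /injectivePn[i [j ij mij]] : ~~ injectiveb m.
    apply/negP => /injectiveP minj.
    have : #|m @: setT| = #|t| by rewrite (im_t setT)// => k; exists k.
    by rewrite card_imset// cardsT; lia.
  by exists i, j.
have injD (a b : I) : a != b -> m a = m b -> {in [set~ a] &, injective m}.
  move=> ab mab; apply/imset_injP.
  rewrite im_t; first by rewrite cardsC1 -cardt.
  move=> k.
  have [->|ka] := eqVneq k a; last by exists k => //; rewrite !inE.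
  by exists b; rewrite ?mab// !inE eq_sym.
have surjD (a b : I) y : a != b -> m a = m b -> y \in t ->
    exists2 l, l != a & m l = y.
  move=> ab mab /m_surj[k <-]; have [->|ka] := eqVneq k a; last by exists k.
  by exists b; rewrite 1?eq_sym.
have ext_top (a b : I) y : a != b -> m a = m b -> y \notin t ->
    dominant (y |: t) -> (forall x, x \in y |: t -> r a y <= r a x) ->
    top_exceeds t a y.
  move=> ab mab yt /dominantP dyt ya; apply/top_exceedsP; split.
    apply/exceedsP => l la; exists (m l); first by have [] := mP l.
    have [l' Hl'] := dyt (m l).
    have ml' : m l' = m l.
      by apply: m_eq => [|x xt]; [have [] := mP l|apply: Hl'; rewrite !inE xt orbT].
    have l'a : l' != a.
      apply: contraNneq yt => l'a; rewrite l'a in Hl'.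
      rewrite (_ : y = m l); first by have [] := mP l.
      apply: (r_inj (i := a)); apply/eqP; rewrite eqn_leq.
      rewrite ya ?Hl' ?inE ?eqxx//; have [-> _] := mP l; exact: orbT.
    have ll' : l' = l by apply: (injD _ _ ab mab) => //; rewrite !inE.
    have := Hl' y; rewrite ll' !inE eqxx => /(_ isT) mly.
    rewrite ltn_neqAle mly andbT.
    apply: contraNneq yt => /r_inj <-; by have [] := mP l.
  move=> z /exceedsP zt; have [l Hl] := dyt z.
  have [la|/zt[x xt]] := eqVneq l a; first by move: Hl; rewrite la; apply; rewrite !inE eqxx.
  by rewrite ltnNge Hl// !inE xt orbT.
have top_ext (a b : I) y : a != b -> m a = m b -> top_exceeds t a y ->
    (y \notin t) && dominant (y |: t).
  move=> ab mab /top_exceedsP[/exceedsP ey ymax]; apply/andP; split.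
    apply/negP => /(surjD _ _ _ ab mab)[l la mly].
    have [x xt] := ey _ la; rewrite ltnNge -mly.
    by have [_ ->] := mP l.
  apply/dominantP => z; have [/ymax za|] := boolP (exceeds t a z).
    exists a => x; rewrite !inE => /predU1P[->//|xt].
    apply: leq_trans za _; have [l Hl] := dt y.
    have [<-|/ey[x' x't]] := eqVneq l a; first exact: Hl.
    by rewrite ltnNge Hl.
  rewrite negb_forall_in => /exists_inP[k ka].
  rewrite negb_exists_in => /forall_inP Hk; exists k => x.
  rewrite !inE => /predU1P[->|xt]; last by rewrite leqNgt Hk.
  have [x' x't /ltnW] := ey _ ka; apply: leq_trans.
  by rewrite leqNgt Hk.
exists i, j; split => // [y|y]; last first.
  apply/negP => /andP[/top_exceedsP[/exceedsP ei _] /top_exceedsP[/exceedsP ej _]].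
  have [l Hl] := dt y; have [li|/ei[x xt]] := eqVneq l i; last by rewrite ltnNge Hl.
  by have [|x xt] := ej l; [rewrite li|rewrite ltnNge Hl].
apply/idP/orP => [/andP[yt dyt]|[]]; last 2 first.
- exact: top_ext ij mij.
- by apply: (top_ext j i) => //; rewrite eq_sym.
have /dominantP dyt' := dyt; have [k Hk] := dyt' y.
have [ki|ki] := eqVneq k i; first by left; apply: ext_top ij mij _ _ _; rewrite -?ki.
have [kj|kj] := eqVneq k j.
  by right; apply: (ext_top j i); rewrite -?kj// ?kj// eq_sym.
(* Here [y] has taken the place of [m k] as minimum for [k]. Dominance at [m k] then requires
   another order [l] with [m l = m k], a second collision. *)
exfalso; have [mkt mkmin] := mP k; have [l Hl] := dyt' (m k).
have mlk : m l = m k by apply: m_eq => // x xt; apply: Hl; rewrite !inE xt orbT.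
have lk : l != k.
  apply: contraNneq yt => lk; rewrite (_ : y = m k)//.
  apply: (r_inj (i := k)); apply/eqP; rewrite eqn_leq Hk ?inE ?mkt ?orbT//.
  by move: Hl; rewrite lk; apply; rewrite !inE eqxx.
have [li|li] := eqVneq l i.
  have ji : j != i by rewrite eq_sym.
  move: kj; rewrite (_ : k = j) ?eqxx//.
  by apply: (injD _ _ ij mij); rewrite ?inE// -mlk li.
by move: lk; rewrite (_ : l = k) ?eqxx//; apply: (injD _ _ ij mij); rewrite ?inE.
Qed.

Lemma card_dominant_extensions t : dominant t -> t != set0 -> #|t|.+1 = #|I| ->
  (forall i, exists y, exceeds t i y) ->
  #|[set y | (y \notin t) && dominant (y |: t)]| = 2.
Proof.
move=> dt t0 ct ex; have [i [j [ij ext disj]]] := dominant_extensions dt t0 ct.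
rewrite (_ : [set _ | _] = [set y | top_exceeds t i y] :|: [set y | top_exceeds t j y]).
  rewrite cardsU !card_top_exceeds// (_ : _ :&: _ = set0) ?cards0//.
  by apply/setP => y; rewrite !inE (negbTE (disj y)).
by apply/setP => y; rewrite !inE ext.
Qed.

(** Suppose dropping [y] leaves every colour but [i0], hence each exactly once. As [s] misses a
    colour, [c y] is not [i0]; so [y] shares its colour with exactly one other [x] in [s], and
    dropping [x] gives the only other such facet. *)
Lemma card_rainbow_facets_even (i0 : I) s :
  #|s| = #|I| -> c @: s != [set: I] ->
  ~~ odd #|[set y in s | c @: (s :\ y) == ~: [set i0]]|.
Proof.
move=> cs ns; set F := [set y in s | _].
have [->|/set0Pn[y]] := eqVneq F set0; first by rewrite cards0.
rewrite inE => /andP[ys /eqP cy].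
have cyi0 : c y != i0.
  apply: contraNneq ns => cyi0.
  by rewrite -(setD1K ys) imsetU1 cy cyi0 setUCr.
have /imsetP[x xs cxy] : c y \in c @: (s :\ y) by rewrite cy !inE.
move: xs; rewrite !inE => /andP[xy xs].
suff -> : F = [set x; y] by rewrite cards2 xy.
apply/setP => z; rewrite !inE; apply/andP/orP => [[zs /eqP cz]|[/eqP->|/eqP->]].
- apply/orP; rewrite -[_ || _]negbK negb_or; apply/negP => /andP[zx zy].
  have : {in s :\ z &, injective c}.
    by apply/imset_injP; rewrite cz cardsC1; have := cardsD1 z s; rewrite zs; lia.
  move/(_ x y); rewrite !inE xs ys !(eq_sym _ z) zx zy -cxy => /(_ erefl erefl erefl).
  by move=> e; rewrite e eqxx in xy.
- rewrite xs -cy; split => //; apply/eqP.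
  rewrite -(@setD1K _ y (s :\ x)) ?inE 1?eq_sym ?xy ?eqxx ?ys//.
  rewrite -[in RHS](@setD1K _ x (s :\ y)) ?inE ?xy ?xs//.
  by rewrite !imsetU1 cxy !setDDl [[set x; y]]setUC.
- by rewrite ys cy.
Qed.

(* Double counting, modulo 2, of the pairs of a facet [t] carrying every colour
   but [i0] and a point extending it to a dominant set: if no dominant set
   carried all colours, each dominant set would have an even number of such
   facets. *)
Lemma rainbow_dominant_of_parity (i0 : I) t0 :
  #|t0|.+1 = #|I| -> c @: t0 = ~: [set i0] ->
  odd #|[set y | (y \notin t0) && dominant (y |: t0)]| ->
  (forall t, #|t|.+1 = #|I| -> c @: t = ~: [set i0] -> t != t0 ->
     t != set0 /\ forall i, exists y, exceeds t i y) ->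
  exists s, dominant s /\ c @: s = [set: I].
Proof.
move=> ct0 cct0 odd0 H.
case: (pickP [pred s | dominant s & c @: s == [set: I]]) => [s /andP[ds /eqP cs]|nex].
  by exists s.
pose E t y := [&& #|t|.+1 == #|I|, c @: t == ~: [set i0], y \notin t
                & dominant (y |: t)].
pose N := (\sum_t \sum_(y | E t y) 1)%N.
have oddN : odd N.
  rewrite /N (bigD1 t0)//= oddD.
  have -> : odd (\sum_(y | E t0 y) 1)%N.
    move: odd0; rewrite (_ : [set _ | _] = [set y | E t0 y]) ?sum1dep_card//.
    by apply/setP => y; rewrite !inE /E ct0 cct0 !eqxx.
  rewrite addTb.
  elim/big_ind: _ => // [a b|t tt0]; first by rewrite oddD => /negbTE -> /negbTE ->.
  rewrite sum1dep_card.
  have [|] := boolP ((#|t|.+1 == #|I|) && (c @: t == ~: [set i0])); last first.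
    rewrite negb_and => Ht; rewrite (_ : [set _ | _] = set0) ?cards0//.
    apply/setP => y; rewrite !inE /E; apply/negbTE.
    by case/orP: Ht => /negbTE -> //; rewrite andbF.
  move=> /andP[/eqP ct /eqP cct].
  have [tn0 ex] := H t ct cct tt0.
  rewrite (_ : [set _ | _] = [set y | (y \notin t) && dominant (y |: t)]); last first.
    by apply/setP => y; rewrite !inE /E ct cct !eqxx.
  (* A dominant facet contributes two pairs, any other none, since dominance passes to subsets. *)
  have [dt|ndt] := boolP (dominant t); first by rewrite card_dominant_extensions.
  rewrite (_ : [set _ | _] = set0) ?cards0//; apply/setP => y; rewrite !inE.
  apply/negbTE; rewrite negb_and orbC; apply/orP; left.
  by apply: contraNN ndt; apply: dominant_sub; apply: subsetUr.
suff : ~~ odd N by rewrite oddN.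
rewrite /N (exchange_big_dep xpredT)//=.
(* Pairs are regrouped by [s = y |: t], from which the facet is recovered as [s :\ y]. *)
rewrite (eq_bigr (fun y => \sum_(s : {set P} | (y \in s) && E (s :\ y) y) 1)%N); last first.
  move=> y _; rewrite (reindex_onto (fun s => s :\ y) (fun t => y |: t)) /=; last first.
    by move=> t /and4P[_ _ yt _]; rewrite setU1K.
  apply: eq_bigl => s; rewrite andbC; congr (_ && _).
  by apply/eqP/idP => [<-|ys]; rewrite ?setU11// setD1K.
rewrite (exchange_big_dep xpredT)//=.
elim/big_ind: _ => // [a b|s _]; first by rewrite oddD => /negbTE -> /negbTE ->.
rewrite sum1dep_card.
have [/andP[ds /eqP cs]|nds] := boolP (dominant s && (#|s| == #|I|)); last first.
  rewrite (_ : [set _ | _] = set0) ?cards0//; apply/setP => y; rewrite !inE.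
  apply: contraNF nds => /andP[ys /and4P[/eqP cs _ _]].
  rewrite setD1K// => ->; have := cardsD1 y s; rewrite ys => ->.
  by rewrite add1n cs eqxx.
have ns : c @: s != [set: I] by have := nex s; rewrite /= ds /= => ->.
have := card_rainbow_facets_even i0 cs ns; congr (~~ odd #|pred_of_set _|).
apply/setP => y; rewrite !inE; case: (boolP (y \in s)) => //= ys.
have := cardsD1 y s; rewrite ys => cs'.
by rewrite /E !inE eqxx/= setD1K// ds -cs cs' add1n eqxx andbT.
Qed.

End Dominance.

(** One slack point is added per order, in that order's colour. In a dominant set carrying all
    colours, a point of [T] can only be witnessed by an order whose slack point is absent; that
    colour is then carried by a point of [T], so discarding the slack points leaves the required
    [s]. *)
Lemma scarf (T I : finType) (r : I -> T -> nat) (c : T -> I) (t1 : T) :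
  (forall i, injective (r i)) ->
  exists s : {set T}, forall y, exists2 i, i \in c @: s &
    forall x, x \in s -> r i y <= r i x.
Proof.
move=> r_inj; pose i0 := c t1.
pose B := \sum_i \sum_x (r i x).+1.
have rB i x : (r i x).+1 <= B.
  rewrite /B (bigD1 i)//= (bigD1 x)//=; lia.
(* [inr k] is a slack point: below everything for [k], above all of [T] for
   the other orders. *)
pose r' i (p : T + I) := match p with
  | inl x => (r i x).+1
  | inr k => if k == i then 0 else B + (enum_rank k).+1 end.
pose c' (p : T + I) := match p with inl x => c x | inr k => k end.
have r'_inj i : injective (r' i).
  move=> [x|k] [y|l] /=.
  - by move=> [/r_inj ->].
  - by case: eqP => // _ e; have := rB i x; lia.
  - by case: eqP => // _ e; have := rB i y; lia.
  - case: eqP => [->|_]; case: eqP => [->|_]//; try lia.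
    by move=> e; congr inr; apply: enum_rank_inj; apply: val_inj => /=; lia.
have r'0 k p : r' k (inr k) <= r' k p by rewrite /= eqxx.
have r'lt k p : p <> inr k -> r' k (inr k) < r' k p.
  by move=> pk; rewrite ltn_neqAle r'0 andbT; apply: contra_notN pk => /eqP/r'_inj.
pose t0 : {set T + I} := inr @: [set~ i0].
have ct0 : #|t0|.+1 = #|I|.
  rewrite card_imset; last by move=> ? ? [].
  by rewrite cardsC1 prednK//; apply/card_gt0P; exists i0.
have cct0 : c' @: t0 = ~: [set i0].
  by rewrite -imset_comp (eq_imset (g := id)) ?imset_id.
have [||s [/dominantP ds cs]] :=
  @rainbow_dominant_of_parity _ _ r' c' r'_inj i0 t0 ct0 cct0; last first.
- exists [set x | inl x \in s] => y; have [i Hi] := ds (inl y).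
  exists i; last by move=> x; rewrite inE => /Hi.
  have /imsetP[[x|k] xs ix] : i \in c' @: s by rewrite cs.
    by apply/imsetP; exists x; rewrite ?inE.
  by have := Hi _ xs; rewrite ix /= eqxx.
- move=> t ct cct tt0.
  have [x xt] : exists x, inl x \in t.
    case: (pickP (fun x => inl x \in t)) => [x xt|nx]; first by exists x.
    case/negP: tt0; rewrite eqEcard; apply/andP; split; last by rewrite -ltnS ct0 ct.
    apply/subsetP => -[y yt|k kt]; first by rewrite nx in yt.
    apply/imsetP; exists k => //; rewrite -cct; apply/imsetP; by exists (inr k).
  split; first by apply/set0Pn; exists (inl x).
  move=> i; exists (inr i); apply/exceedsP => k ki.
  exists (inl x) => //=; rewrite eq_sym (negbTE ki); have := rB k x; lia.
(* The slack points in [t0] exclude every order but [i0] as a witness at a point of [T], so the only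
   dominant extension is by the [i0]-greatest point of [T]. *)
- suff -> : [set y | (y \notin t0) && dominant r' (y |: t0)] =
     [set inl [arg max_(y > t1) r i0 y]] by rewrite cards1.
  case: arg_maxnP => // x _ max_x.
  have xmax y : r i0 y <= r i0 x by apply: max_x.
  apply/setP => -[y|k]; rewrite !inE; last first.
    apply/andP => -[kt0].
    have -> : k = i0.
      by apply: contraNeq kt0 => ki0; apply/imsetP; exists k; rewrite ?inE.
    move=> /dominantP/(_ (inl t1))[i Hi].
    suff /Hi : inr i \in inr i0 |: t0 by rewrite /= eqxx.
    have [->|ii0] := eqVneq i i0; first by rewrite !inE eqxx.
    by rewrite !inE; apply/orP; right; apply/imsetP; exists i; rewrite ?inE.
  have -> : (inl y \notin t0) by apply/imsetP => -[].
  apply/dominantP/eqP => [dy|[->]].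
    congr inl; apply: (r_inj i0); apply/eqP; rewrite eqn_leq xmax//=.
    have [i Hi] := dy (inl x); have [ii0|ii0] := eqVneq i i0.
      by move: (Hi (inl y)); rewrite ii0 /= !inE eqxx ltnS; apply.
    have /Hi : inr i \in inl y |: t0.
      by rewrite !inE; apply/orP; right; apply/imsetP; exists i; rewrite ?inE.
    by rewrite /= eqxx.
  move=> [z|k].
    exists i0 => p; rewrite !inE => /orP[/eqP->|/imsetP[k]]; first by rewrite /= ltnS xmax.
    by rewrite !inE => /negbTE ki0 -> /=; rewrite ki0; have := rB i0 z; lia.
  by exists k.
Qed.

(** * Grid points of the simplex *)

Local Notation grid n N := {x : {ffun 'I_n -> 'I_N.+1} | (\sum_i (x i : nat) == N)%N}.

Lemma grid_of_fun n N (f : 'I_n -> nat) : \sum_i f i = N ->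
  exists x : grid n N, forall i, val x i = f i :> nat.
Proof.
move=> fN; have f_lt i : f i < N.+1.
  by rewrite -fN (bigD1 i)//= ltnS leq_addr.
have xN : \sum_i [ffun j => Ordinal (f_lt j)] i == N.
  by rewrite -[X in _ == X]fN; apply/eqP/eq_bigr => i _; rewrite ffunE.
by exists (exist (fun x : {ffun 'I_n -> 'I_N.+1} => \sum_i x i == N) _ xN) => i;
  rewrite /= ffunE.
Qed.

(** The excess of [f] over [l] on [S], plus all of [f] off [S], totals [N] minus the sum of [l] over
    [S]. This is at most [#|S| - 1 <= n], so no coordinate can exceed its bound by more than [n]. *)
Lemma near_minorant n N (S : {set 'I_n.+1}) (l f : 'I_n.+1 -> nat) :
  \sum_i f i = N -> N < \sum_(i in S) (l i).+1 ->
  (forall i, i \in S -> l i <= f i) -> forall i, f i <= (i \in S) * l i + n.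
Proof.
move=> fN lN lf i.
have cS : #|S| <= n.+1 by rewrite -[leqRHS](card_ord n.+1) max_card.
have sumS : \sum_(i in S) (l i).+1 = \sum_(i in S) l i + #|S|.
  by rewrite -sum1_card -big_split/=; apply: eq_bigr => j _; rewrite addn1.
have fS : \sum_(i in S) f i + \sum_(i in ~: S) f i = N.
  by rewrite -fN [RHS](bigID (fun j => j \in S)); congr (_ + _); apply: eq_bigl => j;
    rewrite !inE.
have aux x y a b d e : a <= b -> x + b + d = N -> N < y + a + e -> e <= n.+1 ->
  x <= y + n by lia.
move: fS lN; rewrite sumS; have [iS|iS] := boolP (i \in S).
  rewrite mul1n !(big_setD1 i iS)/= => fS lN.
  apply: aux fS lN cS.
  by apply: leq_sum => j; rewrite !inE => /andP[_ /lf].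
rewrite mul0n (big_setD1 (A := ~: S) i) ?inE//= addnCA addnA => fS lN.
have lfS : \sum_(j in S) l j <= \sum_(j in S) f j by apply: leq_sum.
by apply: (aux _ 0 _ _ _ _ lfS fS _ cS).
Qed.

(* The orders are those of the coordinates, with ties broken arbitrarily; the
   coordinatewise minima over a dominant set nearly sum up to [N]. *)
Lemma grid_sperner n N (c : grid n.+1 N -> 'I_n.+1) :
  exists u : grid n.+1 N, forall i, val u i <= n \/
    exists2 v : grid n.+1 N, c v = i &
      forall j, val u j <= val v j + n /\ val v j <= val u j + n.
Proof.
have [t1 _] : exists t : grid n.+1 N,
    forall i, val t i = (if i == ord0 then N else 0) :> nat.
  by apply: grid_of_fun; rewrite -big_mkcond big_pred1_eq.
pose M := #|{: grid n.+1 N}|.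
pose r (i : 'I_n.+1) (x : grid n.+1 N) := val x i * M + enum_rank x.
have rK i x : r i x %/ M = val x i.
  rewrite /r divnMDl ?divn_small ?addn0//.
  exact: leq_ltn_trans (ltn_ord (enum_rank t1)).
have r_inj i : injective (r i).
  move=> x y xy; have := rK i x; rewrite xy rK => xyi.
  by move: xy; rewrite /r xyi => /addnI/val_inj/enum_rank_inj.
have r_le i x y : r i x <= r i y -> val x i <= val y i.
  by rewrite -!rK; apply: leq_div2r.
have [s Hs] := scarf c t1 r_inj.
have {Hs}Hs (y : grid n.+1 N) : exists2 i, i \in c @: s &
    forall x, x \in s -> val y i <= val x i.
  by have [i iC Hi] := Hs y; exists i => // x /Hi; apply: r_le.
have [i1 i1C _] := Hs t1; have /imsetP[u us _] := i1C.
pose l (i : 'I_n.+1) := val [arg min_(x < u in s) (val x i : nat)] i : nat.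
have l_le i (x : grid n.+1 N) : x \in s -> l i <= val x i.
  by rewrite /l; case: arg_minnP => // z _ zmin /zmin.
have l_ge i : exists2 x : grid n.+1 N, x \in s & l i = val x i.
  by rewrite /l; case: arg_minnP => // z zs _; exists z.
have lN : N < \sum_(i in c @: s) (l i).+1.
  (* Otherwise raise each minimum [l i], for [i] a colour of [s], by one and pour the remainder into
     [i1]: the resulting grid point exceeds the minimum over [s] for every colour of [s]. *)
  rewrite ltnNge; apply/negP => lN.
  pose f i := (i \in c @: s) * (l i).+1 +
    (i == i1) * (N - \sum_(i in c @: s) (l i).+1).
  have [|y yE] := @grid_of_fun n.+1 N f.
    have rest K : \sum_i (i == i1) * K = K.
      by rewrite (bigD1 i1)//= eqxx big1 ?addn0 ?mul1n// => i /negbTE ->.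
    rewrite big_split/= rest (bigID (mem (c @: s)))/=.
    rewrite [X in _ + X + _]big1 ?addn0; last by move=> i /negbTE ->.
    rewrite (eq_bigr (fun i => (l i).+1)) ?subnKC// => i ->.
    by rewrite mul1n.
  have [i iC Hi] := Hs y; have [x xs lx] := l_ge i.
  have := Hi _ xs; rewrite yE /f iC mul1n -lx => Hl.
  by move: (leq_trans (leq_addr _ _) Hl); rewrite ltnn.
have lu (x : grid n.+1 N) : x \in s -> forall i, val x i <= (i \in c @: s) * l i + n.
  move=> xs; apply: (near_minorant (N := N)) => //; first exact/eqP/(valP x).
  by move=> i _; apply: l_le.
exists u => i; have [iC|iC] := boolP (i \in c @: s); last first.
  by left; have := lu _ us i; rewrite (negbTE iC).
right; have /imsetP[v vs iv] := iC; exists v => // j.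
have := lu _ us j; have := lu _ vs j.
case: (j \in c @: s); rewrite ?mul1n ?mul0n; last lia.
by have := l_le j _ us; have := l_le j _ vs; lia.
Qed.

From mathcomp Require Import all_order all_algebra.
From mathcomp Require Import all_classical all_reals all_analysis.
From mathcomp Require Import ring lra.
Import Order.TTheory GRing.Theory Num.Theory.
Import numFieldNormedType.Exports.
Local Open Scope classical_set_scope.
Local Open Scope ring_scope.

(** * The KKM covering theorem and Schauder's fixed point theorem *)

Section CompactSequences.
Context {R : realType} {X : normedModType R}.

Lemma compact_seq_cluster (H : set X) (u : nat -> X) :
  compact H -> (forall n, H (u n)) ->
  exists2 h, H h & forall e : R, 0 < e -> forall N, exists2 n, (N <= n)%N & `|u n - h| < e.
Proof.
move=> cH uH; have [|h [Hh uh]] := cH (u @ \oo) _.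
  by exists 0%N => // n _; exact: uH.
exists h => // e e0 N.
have [|_ [[n Nn <-] /= uhe]] := uh (u @` [set n | (N <= n)%N]) (ball h e) _ (nbhsx_ballx h e e0).
  by exists N => // n Nn; exists n.
by exists n => //; rewrite distrC; move: uhe; rewrite -ball_normE.
Qed.

Lemma compact_net (H : set X) (e : R) : compact H -> 0 < e -> H !=set0 ->
  exists n (y : 'I_n.+1 -> X), (forall i, H (y i)) /\
    forall h, H h -> exists i, `|h - y i| < e.
Proof.
move=> cH e0 [h0 Hh0]; have : cover_compact H by rewrite -compact_cover.
move=> /(_ X H (ball^~ e))[h _|h Hh|D DH Hcov].
- exact: ball_open.
- by exists h => //; exact: ballxx.
pose s := h0 :: [seq x <- finmap.enum_fset D | `[< H x >]].
have sH i : (i < size s)%N -> H (nth h0 s i).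
  move=> /(mem_nth h0); rewrite inE => /predU1P[->//|].
  by rewrite mem_filter => /andP[/asboolP].
exists (size [seq x <- finmap.enum_fset D | `[< H x >]]), (fun i => nth h0 s i).
split=> [i|h Hh]; first exact: sH (ltn_ord i).
have [d /= dD] := Hcov _ Hh; rewrite -ball_normE /= => dh.
have ds : d \in s.
  rewrite inE mem_filter orbC; apply/orP; left; apply/andP; split => //.
  by apply/asboolP; have := DH _ dD; rewrite inE.
have := ds; rewrite -index_mem => ids.
by exists (Ordinal ids); rewrite /= nth_index// distrC.
Qed.

End CompactSequences.

Definition simplex (R : realType) n : set 'rV[R]_n :=
  [set t | (forall i, 0 <= t 0 i) /\ \sum_i t 0 i = 1].
Arguments simplex {R} n.

Section KKM.
Context {R : realType}.

Lemma rV_norm_lt n (t : 'rV[R]_n) (e : R) : 0 < e ->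
  `|t| < e <-> forall i, `|t 0 i| < e.
Proof.
move=> e0; rewrite -normrN -sub0r.
change (ball_ (fun x => `|x|) (0 : 'rV[R]_n) e t <-> forall i, `|t 0 i| < e).
rewrite -mx_norm_ball.
split=> [[_ te] i|te].
  by have := te 0 i; rewrite -ball_normE /= !mxE sub0r normrN.
by split=> // i j; rewrite ord1 -ball_normE /= !mxE sub0r normrN.
Qed.

Lemma closed_simplex n : closed (@simplex R n).
Proof.
have -> : @simplex R n = \bigcap_i ((fun t : 'rV[R]_n => t 0 i) @^-1` [set x | 0 <= x]) `&`
    (fun t : 'rV[R]_n => \sum_i t 0 i) @^-1` [set 1].
  by apply/seteqP; split=> t [t0 t1]; split=> // i; have := t0 i; rewrite /= ?num_real//; apply.
apply: closedI.
  apply: closed_bigI => i _; apply: closed_comp; last exact: closed_ge.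
  by move=> x _; exact: coord_continuous.
apply: closed_comp; last exact: closed_eq.
move=> x _; apply: (@continuous_big _ _ _ 0 xpredT add_continuous 'rV[R]_n
  (index_enum 'I_n) (fun i t => t 0 i)) => i _.
exact: coord_continuous.
Qed.

Lemma compact_simplex n : compact (@simplex R n).
Proof.
have cube_compact : compact [set t : 'rV[R]_n | forall i, t ord0 i \in `[(0 : R), 1]].
  by apply: (@rV_compact _ _ (fun=> `[(0 : R), 1]%classic)) => _; exact: segment_compact.
apply: subclosed_compact (@closed_simplex n) cube_compact _.
move=> t [t0 t1] i /=; rewrite in_itv /= t0 -t1 (bigD1 i)//= lerDl.
by apply: sumr_ge0 => j _.
Qed.

(** The second hypothesis says that each [A i] is closed in the simplex. No boundary condition is
    put on the cover; in return, indices of vanishing coordinates are exempt. The point is a cluster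
    point of those given by [grid_sperner] at mesh [1 / k.+1], whose errors are at most
    [n / k.+1]. *)
Lemma kkm_cover n (A : 'I_n.+1 -> set 'rV[R]_n.+1) :
  (forall t, simplex n.+1 t -> exists i, A i t) ->
  (forall i t, simplex n.+1 t -> ~ A i t ->
     exists2 d : R, 0 < d & forall s, simplex n.+1 s -> `|s - t| < d -> ~ A i s) ->
  exists2 t, simplex n.+1 t & forall i, t 0 i != 0 -> A i t.
Proof.
move=> Acov Aclosed.
have approx k : exists u, simplex n.+1 u /\ forall i, u 0 i <= n%:R / k.+1%:R \/
    exists v, [/\ simplex n.+1 v, A i v & forall j, `|v 0 j - u 0 j| <= n%:R / k.+1%:R].
  pose p (x : grid n.+1 k.+1) : 'rV[R]_n.+1 := \row_i ((val x i : nat)%:R / k.+1%:R).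
  have pS x : simplex n.+1 (p x).
    split=> [i|]; first by rewrite mxE divr_ge0.
    under eq_bigr do rewrite mxE.
    by rewrite -mulr_suml -natr_sum (eqP (valP x)) divff.
  have [c cP] := choice (fun x => Acov (p x) (pS x)).
  have [u uP] := grid_sperner c.
  exists (p u); split=> // i; have [ui|[v vi uv]] := uP i; [left|right].
    by rewrite mxE ler_pM2r ?invr_gt0// ler_nat.
  exists (p v); split=> //; first by rewrite -vi.
  move=> j; rewrite !mxE -mulrBl normrM [X in _ * X]gtr0_norm ?invr_gt0//.
  rewrite ler_pM2r ?invr_gt0//; have [uvj vuj] := uv j.
  move: uvj vuj; rewrite -!(ler_nat R) !natrD => uvj vuj.
  by rewrite ler_norml; apply/andP; split; lra.
have [u uP] := choice approx.
have [t tS ut] := @compact_seq_cluster R 'rV[R]_n.+1 _ u (@compact_simplex n.+1)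
  (fun k => (uP k).1).
exists t => // i ti0; apply: contrapT => nA.
have ti : 0 < t 0 i by rewrite lt_neqAle eq_sym ti0; apply: tS.1.
have [d d0 dA] := Aclosed _ _ tS nA.
(* Each alternative costs two errors of size [e]: a small [u k 0 i] forces [t 0 i < e + e], and a
   nearby [v] in [A i] lies within [e + e] of [t]. *)
pose e : R := Num.min d (t 0 i) / 2.
have e0 : 0 < e by rewrite divr_gt0// lt_min d0.
have ed : e + e <= d by rewrite /e -splitr ge_min lexx.
have et : e + e <= t 0 i by rewrite /e -splitr ge_min lexx orbT.
pose N := (Num.truncn (n%:R / e)).+1.
have [k Nk] := ut _ e0 N; rewrite rV_norm_lt// => ukt.
have {}ukt j : u k 0 j - e < t 0 j < u k 0 j + e.
  by have := ukt j; rewrite !mxE ltr_distlC.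
have nk : n%:R / k.+1%:R < e.
  rewrite ltr_pdivrMr// mulrC -ltr_pdivrMr//.
  have : (n%:R / e < N%:R) by rewrite truncnS_gt.
  by move/lt_le_trans; apply; rewrite ler_nat; apply: leq_trans Nk _.
have [uS /(_ i)[ui|[v [vS vA vu]]]] := uP k.
  have /andP[_] := ukt i; move: ui et nk.
  by move: (t 0 i) (u k 0 i) (n%:R / k.+1%:R) => a b q; lra.
apply: dA vS _ vA; apply: lt_le_trans ed.
apply/rV_norm_lt; first by rewrite addr_gt0.
move=> j; rewrite !mxE ltr_distl; have /andP[] := ukt j; have := vu j.
rewrite ler_distl => /andP[]; move: nk.
move: (v 0 j) (u k 0 j) (t 0 j) (n%:R / k.+1%:R) => a b c q *.
by apply/andP; split; lra.
Qed.

End KKM.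

Lemma convex_setP (R : realType) (M : lmodType R) (A : set M) :
  convex_set (M := M) A <->
  forall x y (t : R), A x -> A y -> 0 <= t -> t <= 1 -> A (t *: x + (1 - t) *: y).
Proof.
split=> [cA x y t Ax Ay t0 t1|cA x y l].
  by have := cA x y (Itv01 t0 t1); rewrite !inE; apply.
by rewrite !inE => Ax Ay; apply: cA.
Qed.

Section Convexity.
Context {R : realType} {M : lmodType R}.
Implicit Types A : set M.

Lemma convex_sum A n (t : 'I_n -> R) (y : 'I_n -> M) : convex_set (M := M) A ->
  (forall i, 0 <= t i) -> \sum_i t i = 1 -> (forall i, t i != 0 -> A (y i)) ->
  A (\sum_i t i *: y i).
Proof.
move=> /convex_setP cA; elim: n t y => [|n IH] t y t_ge0.
  by rewrite big_ord0 => /eqP; rewrite eq_sym oner_eq0.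
rewrite !big_ord_recl => t1 Ay.
have rest0 : 0 <= \sum_(i < n) t (lift ord0 i) by apply: sumr_ge0.
have [t0|t0] := eqVneq (t ord0) 0.
  rewrite t0 scale0r add0r; apply: IH => [i||i].
  - exact: t_ge0.
  - by move: t1; rewrite t0 add0r.
  - exact: Ay.
have [s0|s0] := eqVneq (\sum_(i < n) t (lift ord0 i)) 0.
  rewrite big1 ?addr0 => [|i _].
    by move: t1; rewrite s0 addr0 => ->; rewrite scale1r; apply: Ay.
  move/eqP: s0; rewrite psumr_eq0 => [|j _]; last exact: t_ge0.
  by move=> /allP/(_ i (mem_index_enum _))/eqP ->; rewrite scale0r.
rewrite (_ : \sum_(i < n) _ = (1 - t ord0) *:
    \sum_(i < n) (t (lift ord0 i) / (1 - t ord0)) *: y (lift ord0 i)); last first.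
  rewrite scaler_sumr; apply: eq_bigr => i _; rewrite scalerA mulrCA divff ?mulr1//.
  by rewrite -t1 addrC addKr.
have s1 : 1 - t ord0 = \sum_(i < n) t (lift ord0 i) by rewrite -t1 addrC addKr.
apply: cA; [exact: Ay| |exact: t_ge0|by rewrite -t1 lerDl].
rewrite s1; apply: IH => [i||i].
- by rewrite divr_ge0.
- by rewrite -mulr_suml divff.
- rewrite mulf_eq0 negb_or => /andP[ti _]; exact: Ay.
Qed.

End Convexity.

Lemma convex_norm_le (R : realType) (X : normedModType R) (x : X) (e : R) :
  convex_set (M := X) [set y | `|x - y| <= e].
Proof.
apply/convex_setP => y z t /= ye ze t0 t1.
have -> : x - (t *: y + (1 - t) *: z) = t *: (x - y) + (1 - t) *: (x - z).
  by rewrite !scalerBr addrACA -scalerDl [t + _]addrC subrK scale1r opprD.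
rewrite (le_trans (ler_normD _ _))// !normrZ ger0_norm// ger0_norm ?subr_ge0//.
by nra.
Qed.

Lemma convex_norm_lt (R : realType) (X : normedModType R) (x : X) (e : R) :
  convex_set (M := X) [set y | `|x - y| < e].
Proof.
apply/convex_setP => y z t /= ye ze t0 t1.
have := @convex_norm_le R X x (Num.max `|x - y| `|x - z|).
move=> /convex_setP/(_ y z t); rewrite /= !le_max !lexx orbT => /(_ isT isT t0 t1).
by case/orP => /le_lt_trans; apply.
Qed.

Definition continuous_on (R : realType) (X Y : normedModType R) (C : set X)
    (f : X -> Y) : Prop :=
  forall x, C x -> forall e : R, 0 < e -> exists2 d : R, 0 < d &
    forall y, C y -> `|y - x| < d -> `|f y - f x| < e.

Lemma continuous_on_combination (R : realType) (X : normedModType R) n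
    (y : 'I_n -> X) (A : set 'rV[R]_n) :
  continuous_on A (fun t => \sum_i t 0 i *: y i).
Proof.
move=> t _ e e0; pose M : R := \sum_i `|y i|.
have M0 : 0 <= M by apply: sumr_ge0.
have d0 : 0 < e / (M + 1) by rewrite divr_gt0// ltr_wpDl.
exists (e / (M + 1)) => // s _; rewrite rV_norm_lt// => st.
rewrite -sumrB (le_lt_trans (ler_norm_sum _ _ _))//.
apply: (@le_lt_trans _ _ (\sum_i e / (M + 1) * `|y i|)).
  apply: ler_sum => i _; rewrite -scalerBl normrZ ler_wpM2r//.
  by have := st i; rewrite !mxE => /ltW.
rewrite -mulr_sumr -mulrA gtr_pMr// mulrC ltr_pdivrMr ?mul1r ?ltrDl//.
by rewrite ltr_wpDl.
Qed.

Section Schauder.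
Context {R : realType} {X : normedModType R} (C H : set X) (f : X -> X).
Hypotheses (C_convex : convex_set (M := X) C) (C_nonempty : C !=set0)
  (H_compact : compact H) (HC : H `<=` C)
  (f_cont : continuous_on C f) (f_H : forall x, C x -> H (f x)).

(* If [f (Y t)] is within [e] of every vertex [y i] with [t 0 i != 0], then it is
   within [e] of their convex combination [Y t]. *)
Lemma approximate_fixpoint (e : R) : 0 < e -> exists2 x, C x & `|f x - x| <= e.
Proof.
move=> e0; have [x0 Cx0] := C_nonempty.
have [n [y [yH ycov]]] := compact_net H_compact e0 (ex_intro _ _ (f_H Cx0)).
pose Y (t : 'rV[R]_n.+1) := \sum_i t 0 i *: y i.
have YC t : simplex n.+1 t -> C (Y t).
  by move=> [t0 t1]; apply: convex_sum => // i _; exact/HC/yH.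
pose A i (t : 'rV[R]_n.+1) := `|f (Y t) - y i| <= e.
have [t tS|i t tS /negP|t tS At] := @kkm_cover R n A.
- by have [i /ltW] := ycov _ (f_H (YC _ tS)); exists i.
- rewrite -ltNge => et.
  have [d d0 dP] := f_cont (YC _ tS) (e := `|f (Y t) - y i| - e)
    (ltac:(by rewrite subr_gt0)).
  have [d' d'0 d'P] := @continuous_on_combination R X _ y (simplex n.+1) t tS d d0.
  exists d' => // s sS st; apply/negP; rewrite -ltNge.
  have := dP _ (YC _ sS) (d'P _ sS st); rewrite ltrBrDl => h.
  rewrite -(ltrD2r `|f (Y s) - f (Y t)|) (lt_le_trans h)//.
  by rewrite [leRHS]addrC [X in _ <= X + _]distrC ler_distD.
exists (Y t); first exact: YC.
have [t0 t1] := tS.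
by apply: (convex_sum (@convex_norm_le R X (f (Y t)) e) t0 t1).
Qed.

(** The images of approximate fixed points cluster at some [h] in [H], hence so do the points
    themselves. As [h] lies in [C], continuity of [f] on [C] applies there. *)
Theorem schauder : exists2 x, C x & f x = x.
Proof.
have k0 k : 0 < k.+1%:R^-1 :> R by rewrite invr_gt0.
have [x xC] := choice (fun k => let: ex_intro2 x Cx xe := approximate_fixpoint (k0 k)
  in ex_intro (fun x => C x /\ `|f x - x| <= k.+1%:R^-1) x (conj Cx xe)).
have [h Hh hP] := compact_seq_cluster H_compact (fun k => f_H (xC k).1).
exists h; first exact: HC.
apply/eqP; rewrite -subr_eq0 -normr_le0; apply/ler_addgt0Pl => e e0; rewrite addr0.
have [d d0 dP] := f_cont (HC Hh) (e := e / 2) (ltac:(by rewrite divr_gt0)).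
pose m : R := Num.min (d / 2) (e / 2).
have m0 : 0 < m by rewrite lt_min !divr_gt0.
have md : m <= d / 2 by rewrite ge_min lexx.
have me : m <= e / 2 by rewrite ge_min lexx orbT.
have [k Nk fk] := hP _ m0 (Num.truncn m^-1).+1.
have [Cxk xk] := xC k.
have km : k.+1%:R^-1 < m.
  rewrite invf_plt ?posrE//; apply: lt_le_trans (truncnS_gt _) _.
  by rewrite ler_nat (leq_trans Nk).
have {}xk : `|x k - f (x k)| < m by rewrite distrC (le_lt_trans xk).
have /(dP _ Cxk) fkh : `|x k - h| < d.
  rewrite (le_lt_trans (ler_distD (f (x k)) _ _))// (splitr d).
  by rewrite ltrD// (lt_le_trans _ md).
rewrite (le_trans (ler_distD (f (x k)) _ _))// (splitr e) lerD//.
  by rewrite distrC ltW.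
by rewrite ltW// (lt_le_trans fk).
Qed.

End Schauder.

(** * Continuous selections of lower semicontinuous maps *)

Section MetricCharacterizations.
Context {R : realType}.

Lemma closure_normP (X : normedModType R) (A : set X) x :
  closure A x <-> forall e : R, 0 < e -> exists2 y, A y & `|x - y| < e.
Proof.
split=> [Ax e e0|Ax B /nbhs_normP[e /= e0 eB]].
  have [y [Ay xy]] := Ax _ (nbhsx_ballx x e e0).
  by exists y => //; move: xy; rewrite -ball_normE.
by have [y Ay xy] := Ax _ e0; exists y; split=> //; apply: eB.
Qed.

Lemma convex_closure (X : normedModType R) (A : set X) :
  convex_set (M := X) A -> convex_set (M := X) (closure A).
Proof.
move=> /convex_setP cA; apply/convex_setP => x y t /closure_normP Ax /closure_normP Ay.
move=> t0 t1; apply/closure_normP => e e0.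
have [x' Ax' xx'] := Ax _ e0; have [y' Ay' yy'] := Ay _ e0.
exists (t *: x' + (1 - t) *: y'); first exact: cA.
rewrite opprD addrACA -!scalerBr.
rewrite -normrN -sub0r; have /convex_setP := @convex_norm_lt R X 0 e.
by apply=> //=; rewrite sub0r normrN.
Qed.

Lemma continuous_onP (X Y : normedModType R) (C : set X) (f : X -> Y) :
  continuous_on C f <-> forall x, C x -> f @ within C (nbhs x) --> f x.
Proof.
split=> [fC x Cx|fC x Cx e e0].
  apply/cvgrPdist_lt => e e0; have [d d0 dP] := fC x Cx e e0.
  apply/nbhs_normP; exists d => //= y; rewrite /= => xy Cy.
  by rewrite distrC; apply: dP; rewrite // distrC.
have /cvgrPdist_lt/(_ _ e0)/nbhs_normP[d /= d0 dP] := fC x Cx.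
by exists d => // y Cy yx; rewrite distrC; apply: dP => //=; rewrite distrC.
Qed.

Lemma lipschitz_continuous_on (X Y : normedModType R) (C : set X) (f : X -> Y) :
  (forall x y, `|f x - f y| <= `|x - y|) -> continuous_on C f.
Proof. by move=> fL x Cx e e0; exists e => // y _; apply: le_lt_trans. Qed.

End MetricCharacterizations.

Section Depth.
Context {R : realType} {X : normedModType R} (C U : set X).

(** Stands in for the distance from [x] to the part of [C] outside [U], which may be empty: the cap
    at 1 keeps the supremum finite. *)
Let depths x : set R :=
  [set r | 0 <= r <= 1 /\ forall z, C z -> `|z - x| < r -> U z].

Definition depth x : R := sup (depths x).

Let depths0 x : depths x 0.
Proof. by split; rewrite ?lexx ?ler01// => z _; rewrite normr_lt0. Qed.

Let has_sup_depths x : has_sup (depths x).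
Proof. by split; [exists 0|exists 1 => r [/andP[]]]. Qed.

Lemma depth_ge0 x : 0 <= depth x.
Proof. exact: sup_upper_bound (has_sup_depths x) _ (depths0 x). Qed.

Lemma depth_gt0 x (d : R) : 0 < d -> (forall z, C z -> `|z - x| < d -> U z) ->
  0 < depth x.
Proof.
move=> d0 dU; apply: (@lt_le_trans _ _ (Num.min d 1)); first by rewrite lt_min d0 ltr01.
apply: sup_upper_bound (has_sup_depths x) _ _; split.
  by rewrite le_min ltW// ler01 ge_min lexx orbT.
by move=> z Cz zx; apply: dU => //; apply: lt_le_trans zx _; rewrite ge_min lexx.
Qed.

Lemma depth_mem x : C x -> 0 < depth x -> U x.
Proof.
move=> Cx /(sup_gt (ex_intro _ _ (depths0 x)))[r [_ rU] r0].
by apply: rU => //; rewrite subrr normr0.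
Qed.

Lemma depth_lipschitz x y : `|depth x - depth y| <= `|x - y|.
Proof.
suff half a b : depth a <= depth b + `|a - b|.
  by rewrite ler_distl lerBlDr half andbT distrC half.
apply: ge_sup; first by exists 0.
move=> r [/andP[r0 r1] rU].
have [rab|abr] := leP r `|a - b|; first by rewrite (le_trans rab)// lerDr depth_ge0.
rewrite -lerBlDr; apply: sup_upper_bound (has_sup_depths b) _ _; split.
  by rewrite subr_ge0 ltW//= lerBlDr (le_trans r1)// lerDl.
move=> z Cz zb; apply: rU => //.
by rewrite (le_lt_trans (ler_distD b _ _))// [`|b - a|]distrC -ltrBrDr.
Qed.

End Depth.

Lemma half_power_lt (R : realType) (c e : R) : 0 < e -> exists n, c / 2 ^+ n < e.
Proof.
move=> e0; exists (Num.truncn (c / e)).+1.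
rewrite ltr_pdivrMr ?exprn_gt0// [ltRHS]mulrC -ltr_pdivrMr//.
apply: lt_le_trans (truncnS_gt _) _.
by rewrite -natrX ler_nat ltnW// ltn_expl.
Qed.

Section UniformLimit.
Context {R : realType} {X : normedModType R} {Y : completeNormedModType R}.

Lemma geometric_limit (a : nat -> Y) (M : R) :
  (forall n, `|a n - a n.+1| <= M / 2 ^+ n) ->
  exists l, forall n, `|a n - l| <= 2 * M / 2 ^+ n.
Proof.
move=> aM; have M0 : 0 <= M by have := aM 0%N; rewrite expr0 divr1; apply: le_trans.
have aD n k : `|a n - a (n + k)%N| <= 2 * M / 2 ^+ n.
  (* Subtracting the remaining tail gives a bound that induction on [k] preserves. *)
  suff : `|a n - a (n + k)%N| <= 2 * M / 2 ^+ n - 2 * M / 2 ^+ (n + k).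
    by move/le_trans; apply; rewrite gerBl divr_ge0// ?mulr_ge0// exprn_ge0.
  elim: k => [|k IH]; first by rewrite addn0 !subrr normr0.
  rewrite (le_trans (ler_distD (a (n + k)%N) _ _))//.
  rewrite (le_trans (lerD IH (lexx _)))//.
  have := aM (n + k)%N; rewrite !addnS exprS invfM; lra.
have : cvg (a @ \oo).
  apply/cauchy_cvgP/cauchy_exP => e e0; have [n ne] := half_power_lt (2 * M) e0.
  exists (a n); exists n => // k /= nk; rewrite -ball_normE /=.
  by apply: le_lt_trans ne; rewrite -(subnKC nk).
move=> acvg; exists (lim (a @ \oo)) => n; apply/ler_addgt0Pr => e e0.
have /cvgrPdist_lt/(_ _ e0)[k _ /(_ (n + k)%N)] := acvg.
rewrite /= leq_addl => /(_ isT) ke.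
by rewrite (le_trans (ler_distD (a (n + k)%N) _ _))// lerD// ltW// distrC.
Qed.

Lemma uniform_geometric_limit (C : set X) (f : nat -> X -> Y) (M : R) :
  (forall n, continuous_on C (f n)) ->
  (forall n x, C x -> `|f n x - f n.+1 x| <= M / 2 ^+ n) ->
  exists g, continuous_on C g /\ forall n x, C x -> `|f n x - g x| <= 2 * M / 2 ^+ n.
Proof.
move=> f_cont fM.
have lim_ex x : exists l, C x -> forall n, `|f n x - l| <= 2 * M / 2 ^+ n.
  have [Cx|nCx] := pselect (C x); last by exists 0.
  by have [l lP] := geometric_limit (fun n => fM n x Cx); exists l.
have [g gP] := choice lim_ex; exists g; split; last by move=> n x Cx; apply: gP.
move=> x Cx e e0.
have M0 : 0 <= M by have := fM 0%N _ Cx; rewrite expr0 divr1; apply: le_trans.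
have [n ne] := half_power_lt (2 * M) (divr_gt0 e0 (ltr0n R 3)).
have [d d0 dP] := f_cont n _ Cx (e / 3) (ltac:(by rewrite divr_gt0)).
exists d => // y Cy yx; have fyx := dP _ Cy yx.
have gy := le_lt_trans (gP _ Cy n) ne; have gx := le_lt_trans (gP _ Cx n) ne.
rewrite (le_lt_trans (ler_distD (f n y) _ _))// distrC.
rewrite (le_lt_trans (lerD (lexx _) (ler_distD (f n x) _ _)))//.
have -> : e = e / 3 + (e / 3 + e / 3) by field.
by rewrite !ltrD.
Qed.

End UniformLimit.

Definition lower_sc (R : realType) (X : normedModType R) (C : set X)
    (phi : X -> set X) : Prop :=
  forall x, C x -> forall y, phi x y -> forall e : R, 0 < e ->
    exists2 d : R, 0 < d & forall z, C z -> `|z - x| < d ->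
      exists2 w, phi z w & `|w - y| < e.

Section Selections.
Context {R : realType} {X : completeNormedModType R} (C H : set X).
Hypothesis H_compact : compact H.
Implicit Types (phi : X -> set X).

Let valued phi := forall x, C x ->
  [/\ phi x !=set0, convex_set (M := X) (phi x) & phi x `<=` H].

(** Off the closed set [F], nothing is cut away nearby. On [F], the graph of [O] is open, so values
    of [phi] at nearby points that approximate [y] closely enough survive the cut. *)
Lemma lower_sc_restrict phi (F : set X) (O : X -> set X) : lower_sc C phi ->
  (forall x, C x -> ~ F x -> exists2 d : R, 0 < d &
     forall z, C z -> `|z - x| < d -> ~ F z) ->
  (forall x y, C x -> F x -> phi x y -> O x y -> exists2 d : R, 0 < d &
     forall z w, C z -> `|z - x| < d -> `|w - y| < d -> O z w) ->
  lower_sc C (fun x => phi x `&` [set y | F x -> O x y]).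
Proof.
move=> phi_lsc F_closed O_open x Cx y [phixy FO] e e0.
have [Fx|nFx] := pselect (F x); last first.
  have [d d0 dP] := phi_lsc _ Cx _ phixy _ e0; have [d' d'0 d'P] := F_closed _ Cx nFx.
  exists (Num.min d d') => [|z Cz]; first by rewrite lt_min d0.
  rewrite lt_min => /andP[zd zd']; have [w zw wy] := dP _ Cz zd.
  by exists w => //; split=> // Fz; case: (d'P _ Cz zd').
have [d' d'0 d'P] := O_open _ _ Cx Fx phixy (FO Fx).
have [d d0 dP] := phi_lsc _ Cx _ phixy (Num.min e d') (ltac:(by rewrite lt_min e0)).
exists (Num.min d d') => [|z Cz]; first by rewrite lt_min d0.
rewrite lt_min => /andP[zd zd']; have [w zw] := dP _ Cz zd.
rewrite lt_min => /andP[we wd']; exists w => //; split=> // _; exact: d'P.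
Qed.

(** A finite net of [H] is averaged with a partition of unity built from the depths in the sets
    [U i]. Only net points within [e] of [phi x] get positive weight at [x], and [phi x] is
    convex. *)
Lemma approximate_selection phi (e : R) : C !=set0 -> lower_sc C phi -> valued phi ->
  0 < e -> exists2 f : X -> X, continuous_on C f &
    forall x, C x -> exists2 y, phi x y & `|f x - y| < e.
Proof.
move=> [x0 Cx0] phi_lsc phiP e0.
have [n [y [yH ycov]]] : exists n (y : 'I_n.+1 -> X), (forall i, H (y i)) /\
    forall h, H h -> exists i, `|h - y i| < e.
  apply: compact_net => //; have [[y0 y0P] _ sub] := phiP _ Cx0.
  by exists y0; apply: sub y0P.
pose U i : set X := [set x | exists2 z, phi x z & `|y i - z| < e].
pose p i := depth C (U i).
have p_ge0 i x : 0 <= p i x by exact: depth_ge0.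
pose s x := \sum_i p i x.
have s_gt0 x : C x -> 0 < s x.
  move=> Cx; have [[z xz] _ sub] := phiP _ Cx; have [i zi] := ycov _ (sub _ xz).
  rewrite /s (bigD1 i)//= ltr_pwDl ?sumr_ge0//.
  have [d d0 dP] := phi_lsc _ Cx _ xz (e - `|z - y i|) (ltac:(by rewrite subr_gt0)).
  apply: depth_gt0 d0 _ => w Cw wx; have [v wv vz] := dP _ Cw wx.
  exists v => //; rewrite (le_lt_trans (ler_distD z _ _))// addrC distrC.
  by rewrite [`|y i - z|]distrC -ltrBrDr.
exists (fun x => \sum_i (p i x / s x) *: y i).
  apply/continuous_onP => x Cx.
  have p_cont i : p i @ within C (nbhs x) --> p i x.
    suff /continuous_onP : @continuous_on R X R^o C (p i) by exact.
    by apply: lipschitz_continuous_on => *; exact: depth_lipschitz.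
  have s_cont : s @ within C (nbhs x) --> s x.
    apply: (@cvg_big _ _ _ _ _ (@add_continuous _)) => i _; exact: p_cont.
  apply: (@cvg_big _ _ _ _ _ (@add_continuous _)) => i _.
  apply: cvgZ; last exact: cvg_cst.
  apply: cvgM; first exact: p_cont.
  by apply: cvgV s_cont; rewrite gt_eqF// s_gt0.
move=> x Cx; have [phi0 phi_convex _] := phiP _ Cx.
have sum1 : \sum_i (p i x / s x) = 1 by rewrite -mulr_suml divff// gt_eqF// s_gt0.
have w_ge0 i : 0 <= p i x / s x by rewrite divr_ge0// ltW// s_gt0.
have yi i : exists y', p i x / s x != 0 -> phi x y' /\ `|y i - y'| < e.
  have [[z xz zi]|nU] := pselect (U i x); first by exists z.
  exists 0; have [pi0|pi0] := eqVneq (p i x) 0; first by rewrite pi0 mul0r eqxx.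
  by case: nU; apply: (depth_mem Cx); rewrite lt_neqAle eq_sym pi0 p_ge0.
have [y' y'P] := choice yi.
exists (\sum_i (p i x / s x) *: y' i).
  by apply: convex_sum => // i /y'P[].
rewrite -sumrB; under eq_bigr do rewrite -scalerBr.
have := @convex_sum _ _ _ n.+1 (fun i => p i x / s x) (fun i => y i - y' i)
  (@convex_norm_lt R X 0 e) w_ge0 sum1.
rewrite /= sub0r normrN; apply => i /y'P[_].
by rewrite /= sub0r normrN.
Qed.

(** Cutting [phi x] down to the ball of radius [a] at [f x] keeps it lower semicontinuous and
    nonempty, so approximating the cut map to within [b] does not stray from [f]. *)
Lemma refine_selection phi (f : X -> X) (a b : R) : C !=set0 ->
  lower_sc C phi -> valued phi -> continuous_on C f ->
  (forall x, C x -> exists2 y, phi x y & `|f x - y| < a) -> 0 < b ->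
  exists g : X -> X, [/\ continuous_on C g,
    forall x, C x -> exists2 y, phi x y & `|g x - y| < b &
    forall x, C x -> `|f x - g x| < a + b].
Proof.
move=> C0 phi_lsc phiP f_cont fa b0.
pose psi x := phi x `&` [set y | setT x -> `|f x - y| < a].
have psi_lsc : lower_sc C psi.
  apply: lower_sc_restrict => // [x _ []//|x y Cx _ xy fxy].
  have e0 : 0 < (a - `|f x - y|) / 2 by rewrite divr_gt0// subr_gt0.
  have [d d0 dP] := f_cont _ Cx _ e0.
  exists (Num.min d ((a - `|f x - y|) / 2)) => [|z w Cz]; first by rewrite lt_min d0.
  rewrite !lt_min => /andP[/(dP _ Cz) zx _] /andP[_ wy].
  rewrite (le_lt_trans (ler_distD (f x) _ _))//.
  have := ler_distD y (f x) w; rewrite [`|y - w|]distrC.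
  move: zx wy.
  move: (`|f x - y|) (`|f z - f x|) (`|w - y|) (`|f x - w|) => *; lra.
have psiP : forall x, C x ->
    [/\ psi x !=set0, convex_set (M := X) (psi x) & psi x `<=` H].
  move=> x Cx; have [_ phi_convex phiH] := phiP _ Cx; split.
  - by have [y xy fy] := fa _ Cx; exists y; split.
  - apply/convex_setP => u v t [xu /(_ I) fu] [xv /(_ I) fv] t0 t1; split.
      by move/convex_setP: phi_convex; apply.
    by move=> _; have /convex_setP := @convex_norm_lt R X (f x) a; apply.
  - by move=> y [/phiH].
have [g g_cont gP] := approximate_selection C0 psi_lsc psiP b0.
exists g; split=> // x Cx; have [y [xy /(_ I) fy] gy] := gP _ Cx; first by exists y.
by rewrite (le_lt_trans (ler_distD y _ _))// [`|y - g x|]distrC ltrD.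
Qed.

(** Successive refinements differ by at most [2 / 2 ^+ n] and converge uniformly. The values are not
    assumed closed, whence the closure in the conclusion. *)
Theorem michael_selection phi : C !=set0 -> lower_sc C phi -> valued phi ->
  exists2 f : X -> X, continuous_on C f & forall x, C x -> closure (phi x) (f x).
Proof.
move=> C0 phi_lsc phiP.
pose good n (f : X -> X) := continuous_on C f /\
  forall x, C x -> exists2 y, phi x y & `|f x - y| < 1 / 2 ^+ n.
have pow_gt0 n : 0 < 1 / 2 ^+ n :> R by rewrite divr_gt0// exprn_gt0.
have next (nf : nat * (X -> X)) : exists g, good nf.1 nf.2 -> good nf.1.+1 g /\
    forall x, C x -> `|nf.2 x - g x| < 1 / 2 ^+ nf.1 + 1 / 2 ^+ nf.1.+1.
  have [[f_cont fa]|ng] := pselect (good nf.1 nf.2); last by exists nf.2.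
  have [g [gc gb fg]] := refine_selection C0 phi_lsc phiP f_cont fa (pow_gt0 nf.1.+1).
  by exists g.
have [F FP] := choice next.
have [f0 f0c f0P] := approximate_selection C0 phi_lsc phiP (pow_gt0 0%N).
pose f := fix f n := if n is m.+1 then F (m, f m) else f0.
have f_good n : good n (f n).
  by elim: n => [//|n IH]; exact: (FP (n, f n) IH).1.
have [n x Cx|g [g_cont gP]] := @uniform_geometric_limit _ _ _ C f 2 (fun n => (f_good n).1).
  have /= := (FP (n, f n) (f_good n)).2 _ Cx.
  move/ltW/le_trans; apply; rewrite exprS invfM.
  have : 0 <= (2 ^+ n)^-1 :> R by rewrite invr_ge0 exprn_ge0.
  lra.
exists g => // x Cx; apply/closure_normP => e e0.
(* [4 / 2 ^+ n] bounds the distance from [f n x] to the limit, and [1 / 2 ^+ n] the distance to a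
   point of [phi x]. *)
have [n ne] := half_power_lt 5 e0.
have [y xy fy] := (f_good n).2 _ Cx; exists y => //.
rewrite (le_lt_trans (ler_distD (f n x) _ _))// distrC.
move: (gP n _ Cx) fy ne.
by move: (`|f n x - g x|) (`|f n x - y|) => *; lra.
Qed.

End Selections.

(** * Selections through inside points *)

Section InsideSelection.
Context {R : realType} {X : completeNormedModType R} (C H : set X)
  (phi : X -> set X).
Hypotheses (C_nonempty : C !=set0) (H_compact : compact H) (phi_lsc : lower_sc C phi)
  (phi_nonempty : forall x, C x -> phi x !=set0)
  (phi_convex : forall x, C x -> convex_set (M := X) (phi x))
  (phi_H : forall x, C x -> phi x `<=` H).

Let pow_gt0 n : 0 < 1 / 2 ^+ n :> R.
Proof. by rewrite divr_gt0// exprn_gt0. Qed.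

(* [y k i] ranges over a finite [2^-k]-net. Where [phi] meets the ball at
   [y k i] with a margin [2^-j], which is a closed condition, the values of
   [phi] may be cut down to that ball without losing semicontinuity. *)
Lemma dense_selections : exists f : nat -> X -> X,
  [/\ forall n, continuous_on C (f n),
      forall n x, C x -> closure (phi x) (f n x) &
      forall x y, C x -> phi x y -> forall e : R, 0 < e ->
        exists n, `|f n x - y| < e].
Proof.
have H0 : H !=set0.
  have [x0 Cx0] := C_nonempty; have [y xy] := phi_nonempty Cx0.
  by exists y; exact: phi_H xy.
have net k : exists y : nat -> X, forall h, H h -> exists i, `|h - y i| < 1 / 2 ^+ k.
  have [n [y [_ ycov]]] := compact_net H_compact (pow_gt0 k) H0.
  exists (fun i => y (inord i)) => h /ycov[i hi].
  by exists i; rewrite inord_val.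
have [y ycov] := choice net.
pose U k i x := exists2 w, phi x w & `|y k i - w| < 1 / 2 ^+ k.
pose F k i j x := forall z, C z -> `|z - x| < 1 / 2 ^+ j -> U k i z.
pose psi (p : nat * nat * nat) x := phi x `&`
  [set w | F p.1.1 p.1.2 p.2 x -> `|y p.1.1 p.1.2 - w| < 1 / 2 ^+ p.1.1].
have psi_lsc p : lower_sc C (psi p).
  case: p => [[k i] j]; apply: lower_sc_restrict => //= [x Cx|x w Cx _ _ xw].
    rewrite /F => /existsNP[z /not_implyP[Cz /not_implyP[zx nU]]].
    exists (1 / 2 ^+ j - `|z - x|) => [|x' Cx' x'x]; first by rewrite subr_gt0.
    move=> /(_ z Cz) H'; apply: nU; apply: H'.
    by rewrite (le_lt_trans (ler_distD x _ _))// [`|x - x'|]distrC -ltrBrDl.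
  exists (1 / 2 ^+ k - `|y k i - w|) => [|x' w' _ _ w'w]; first by rewrite subr_gt0.
  by rewrite (le_lt_trans (ler_distD w _ _))// [`|w - w'|]distrC -ltrBrDl.
have psiP p x : C x -> [/\ psi p x !=set0, convex_set (M := X) (psi p x) & psi p x `<=` H].
  case: p => [[k i] j] Cx; split.
  - have [Fx|nFx] := pselect (F k i j x).
      have [|w xw yw] := Fx x Cx; first by rewrite subrr normr0.
      by exists w; split.
    by have [w xw] := phi_nonempty Cx; exists w; split.
  - apply/convex_setP => u v t [xu Fu] [xv Fv] t0 t1; split.
      by have /convex_setP := phi_convex Cx; apply.
    move=> /= Fx; have /convex_setP := @convex_norm_lt R X (y k i) (1 / 2 ^+ k).
    by apply=> //; [exact: Fu|exact: Fv].
  - by move=> w [xw _]; exact: phi_H xw.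
have sel p : exists f : X -> X, continuous_on C f /\
    forall x, C x -> closure (psi p x) (f x).
  by have [f fc fP] := michael_selection H_compact C_nonempty (psi_lsc p) (psiP p);
    exists f.
have [g gP] := choice sel.
exists (fun n => g (odflt (0, 0, 0)%N (unpickle n))); split=> [n|n x Cx|x w Cx xw e e0].
- exact: (gP _).1.
- by apply: closureS ((gP _).2 x Cx) => z [].
have [k ke] := half_power_lt 1 (divr_gt0 e0 (ltr0n R 3)).
have [i wi] := ycov k w (phi_H Cx xw).
(* The margin of [w] inside the ball at [y k i] makes [phi] meet that ball on a whole neighbourhood
   of [x], which gives [F k i j x] for large [j]. *)
have [d d0 dP] := phi_lsc Cx xw (e := 1 / 2 ^+ k - `|w - y k i|)
  (ltac:(by rewrite subr_gt0)).
have [j jd] := half_power_lt 1 d0.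
have Fx : F k i j x.
  move=> z Cz zx; have [v zv vw] := dP _ Cz (lt_trans zx jd).
  exists v => //; rewrite (le_lt_trans (ler_distD w _ _))//.
  by rewrite [`|y k i - w|]distrC [`|w - v|]distrC -ltrBrDl.
exists (pickle (k, i, j)); rewrite pickleK /=.
have /closure_normP/(_ (e / 3) (divr_gt0 e0 (ltr0n R 3)))[v [_ /(_ Fx) /= yv] gv] :=
  (gP (k, i, j)).2 _ Cx.
rewrite (le_lt_trans (ler_distD v _ _))//.
have -> : e = e / 3 + (e / 3 + e / 3) by field.
rewrite ltrD// (le_lt_trans (ler_distD (y k i) _ _))// ltrD//.
  by rewrite distrC (lt_trans yv).
by rewrite distrC (lt_trans wi).
Qed.

Lemma closure_phi_H x : C x -> closure (phi x) `<=` H.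
Proof.
move=> Cx; apply: subset_trans (closureS (phi_H Cx)) _.
have : closed H by apply: compact_closed.
by move=> /closure_id <-.
Qed.

(** Places the infinite average strictly inside a segment of [A] starting at its [m]-th term, the
    form to which the definition of a face applies. *)
Lemma half_series_split (A : set X) (a : nat -> X) (l : X) (m : nat) :
  convex_set (M := X) A -> closed A -> (forall n, A (a n)) ->
  (forall e : R, 0 < e -> exists N, forall n, (N <= n)%N ->
     `|\sum_(i < n) (1 / 2 ^+ i.+1) *: a i - l| < e) ->
  exists2 w, A w & l = (1 / 2 ^+ m.+1) *: a m + (1 - 1 / 2 ^+ m.+1) *: w.
Proof.
move=> A_convex A_closed Aa al; pose c n : R := 1 / 2 ^+ n.+1.
have c0 n : 0 < c n by exact: pow_gt0.
have c1 : 0 < 1 - c m.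
  rewrite subr_gt0 /c ltr_pdivrMr ?exprn_gt0// mul1r exprS.
  have : 1 <= 2 ^+ m :> R by rewrite exprn_ege1// ler1n.
  by lra.
have sum_c n : \sum_(i < n) c i = 1 - 1 / 2 ^+ n.
  elim: n => [|n IH]; first by rewrite big_ord0 expr0 divr1 subrr.
  by rewrite big_ord_recr /= IH /c exprS invfM; lra.
exists ((1 - c m)^-1 *: (l - c m *: a m)); last first.
  by rewrite scalerA divff ?gt_eqF// scale1r addrC subrK.
rewrite ((closure_id A).1 A_closed); apply/closure_normP => e e0.
have [N NP] := al (e / 2 * (1 - c m)) (ltac:(by rewrite mulr_gt0 ?divr_gt0)).
have am0 : 0 < `|a m| + 1 by rewrite ltr_wpDl.
have [K Ke] := half_power_lt 1 (divr_gt0 (mulr_gt0 (divr_gt0 e0 (ltr0n R 2)) c1) am0).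
pose n := (maxn N (maxn K m.+1)).
have mn : (m < n)%N by rewrite /n; lia.
have Nn : (N <= n)%N by rewrite /n; lia.
have Kn : (K <= n)%N by rewrite /n; lia.
(* The [n]-th partial sum lacks mass [2^-n]: giving it to [a m] turns the sum
   into a convex combination even after [c m *: a m] is taken away. *)
pose mo := Ordinal mn.
pose t (i : 'I_n) := (if i == mo then 1 / 2 ^+ n else c i) / (1 - c m).
have split_c (V : lmodType R) (F : 'I_n -> V) :
    \sum_i (if i == mo then 1 / 2 ^+ n else c i) *: F i =
    \sum_(i < n) c i *: F i - c m *: F mo + (1 / 2 ^+ n) *: F mo.
  rewrite (bigD1 mo)//= eqxx [in RHS](bigD1 mo)//= [X in _ = X + _]addrAC subrr add0r addrC.
  by congr (_ + _); apply: eq_bigr => i /negbTE ->.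
exists (\sum_i t i *: a i).
  apply: convex_sum => // [i|].
    by rewrite /t divr_ge0 ?(ltW c1)//; case: ifP => _; exact: ltW.
  rewrite -mulr_suml; have := split_c R^o (fun=> 1).
  under eq_bigr do rewrite /GRing.scale/= mulr1.
  move=> ->; under eq_bigr do rewrite /GRing.scale/= mulr1.
  rewrite /GRing.scale/= !mulr1 sum_c.
  by rewrite (_ : _ + _ = 1 - c m) ?divff ?gt_eqF//; lra.
rewrite /t; under eq_bigr do rewrite mulrC -scalerA.
rewrite -scaler_sumr split_c -scalerBr normrZ gtr0_norm ?invr_gt0//.
rewrite mulrC ltr_pdivrMr//.
set S := \sum_(i < n) _.
have -> : l - c m *: a m - (S - c m *: a m + (1 / 2 ^+ n) *: a m) =
    - ((S - l) + (1 / 2 ^+ n) *: a m).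
  by rewrite !opprD !opprK addrA addrACA addNr addr0 [l - S]addrC.
rewrite normrN.
rewrite (le_lt_trans (ler_normD _ _))// (splitr (e * _)) ltrD//.
  by rewrite [ltRHS]mulrAC; exact: (NP n Nn).
rewrite normrZ gtr0_norm// [ltRHS]mulrAC.
apply: le_lt_trans (_ : 1 / 2 ^+ K * (`|a m| + 1) < _); last first.
  by rewrite -ltr_pdivlMr.
rewrite ler_pM ?(ltW (pow_gt0 n)) ?lerDl//.
by rewrite !div1r lef_pV2 ?posrE ?exprn_gt0// ler_eXn2l ?ltr1n.
Qed.

(* A face containing the average [\sum_n g n x / 2^(n+1)] of a dense sequence in
   [phi x] contains every [g n x], hence, if closed, all of [closure (phi x)]. *)
Theorem inside_selection : exists2 f : X -> X, continuous_on C f &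
  forall x, C x -> inside_points (closure (phi x)) (f x).
Proof.
have [g [g_cont g_cl g_dense]] := dense_selections.
have [B HB] : exists B : R, forall h, H h -> `|h| <= B.
  have [B [_ BP]] := compact_bounded H_compact.
  by exists (B + 1); apply: BP; rewrite ltrDl.
pose S n x := \sum_(i < n) (1 / 2 ^+ i.+1) *: g i x.
have S_cont n : continuous_on C (S n).
  apply/continuous_onP => x Cx.
  apply: (@cvg_big _ _ _ _ _ (@add_continuous _)) => i _.
  by apply: cvgZ; [exact: cvg_cst|exact: (continuous_onP _ _).1 (g_cont i) _ Cx].
(* Consecutive partial sums differ by a vector of norm at most [B / 2 ^+ n.+1], hence the constant
   [B / 2]. *)
have [n x Cx|f [f_cont fS]] := @uniform_geometric_limit _ _ _ C S (B / 2) S_cont.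
  rewrite /S big_ord_recr /= opprD addNKr normrN normrZ gtr0_norm//.
  rewrite -[B / 2 / _]mulrA -invfM -exprS div1r mulrC ler_wpM2r ?invr_ge0 ?exprn_ge0//.
  exact/HB/(closure_phi_H Cx)/g_cl.
exists f => // x Cx.
have cl_cl : closure (closure (phi x)) = closure (phi x).
  by rewrite -((closure_id _).1 (@closed_closure _ _)).
have split_f m := half_series_split m (convex_closure (phi_convex Cx))
  (@closed_closure _ _) (fun n => g_cl n x Cx) (l := f x).
have {}split_f m : exists2 w, closure (phi x) w &
    f x = (1 / 2 ^+ m.+1) *: g m x + (1 - 1 / 2 ^+ m.+1) *: w.
  apply: split_f => e e0.
  have B0 : 0 < `|B| + 1 by rewrite ltr_wpDl.
  have [N Ne] := half_power_lt 1 (divr_gt0 e0 B0); exists N => n Nn.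
  apply: le_lt_trans (fS n x Cx) _.
  apply: (@le_lt_trans _ _ (1 / 2 ^+ N * (`|B| + 1))); last by rewrite -ltr_pdivlMr.
  rewrite [2 * _]mulrC divfK ?pnatr_eq0// div1r mulrC.
  apply: (@le_trans _ _ ((2 ^+ n)^-1 * (`|B| + 1))).
    by rewrite ler_wpM2l ?invr_ge0 ?exprn_ge0// (le_trans (ler_norm _))// lerDl.
  by rewrite ler_wpM2r ?(ltW B0)// lef_pV2 ?posrE ?exprn_gt0// ler_eXn2l ?ltr1n.
have c01 m : 0 < 1 / 2 ^+ m.+1 :> R /\ 1 / 2 ^+ m.+1 < 1 :> R.
  split; first exact: pow_gt0.
  by rewrite ltr_pdivrMr ?exprn_gt0// mul1r exprn_egt1 ?ltr1n.
split.
  have [w Aw ->] := split_f 0%N; have [c0 c1] := c01 0%N.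
  have /convex_setP := convex_closure (phi_convex Cx); apply=> //; last exact: ltW.
  exact: g_cl.
move=> [F [[F_convex FA F_face] F_closed Fn] Ff]; apply: Fn.
rewrite cl_cl in FA F_face *; apply/seteqP; split=> // z Az.
have Fg m : F (g m x).
  have [w Aw fw] := split_f m; have [c0 c1] := c01 m.
  by move: Ff; rewrite fw => /(F_face _ _ _ (g_cl m x Cx) Aw c0 c1)[].
rewrite ((closure_id F).1 F_closed); apply/closure_normP => e e0.
have /closure_normP/(_ (e / 2) (divr_gt0 e0 (ltr0n R 2)))[y xy zy] := Az.
have [m my] := g_dense x y Cx xy _ (divr_gt0 e0 (ltr0n R 2)).
exists (g m x) => //; rewrite (le_lt_trans (ler_distD y _ _))// (splitr e) ltrD//.
by rewrite distrC.
Qed.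

End InsideSelection.

(** * The weak* dual and the variational inequality *)

Section WeakDual.
Context {R : realType} {X : normedModType R}.
Implicit Types (f g : weak_dual X) (x y v : X).

(* Needed because [compact_cover] is stated for pointed spaces. *)
HB.instance Definition _ := isPointed.Build (weak_dual X) 0.

Lemma pairing_linear f : linear (pairing f : X -> R^o).
Proof. by have /in_dualP[] := dual_valP f. Qed.

Lemma pairing_continuous f : continuous (pairing f : X -> R^o).
Proof. by have /in_dualP[] := dual_valP f. Qed.

Lemma pairing0 f : pairing f 0 = 0.
Proof.
have := pairing_linear f 1 0 0; rewrite !scale1r addr0 => /eqP.
by rewrite -subr_eq subrr eq_sym => /eqP.
Qed.

Lemma pairingD f x y : pairing f (x + y) = pairing f x + pairing f y.
Proof. by have := pairing_linear f 1 x y; rewrite !scale1r. Qed.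

Lemma pairingZ f (a : R) x : pairing f (a *: x) = a * pairing f x.
Proof. by have := pairing_linear f a x 0; rewrite !addr0 pairing0 addr0. Qed.

Lemma pairingB f x y : pairing f (x - y) = pairing f x - pairing f y.
Proof. by rewrite -scaleN1r pairingD pairingZ mulN1r. Qed.

Lemma pairing_sum f n (F : 'I_n -> X) :
  pairing f (\sum_i F i) = \sum_i pairing f (F i).
Proof. by elim/big_ind2: _ => [|x a y b <- <-|//]; rewrite ?pairing0 ?pairingD. Qed.

Lemma comb_pairing f g (a b : R) x :
  pairing (a *: f + b *: g) x = a * pairing f x + b * pairing g x.
Proof. by []. Qed.

Lemma eval_continuous v : continuous (fun f => pairing f v : R^o).
Proof.
move=> f; apply: (@continuous_comp _ _ _ (@dual_val R X : weak_dual X -> {ptws X -> R^o})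
  (fun h : {ptws X -> R^o} => h v)).
  exact: initial_continuous.
exact: proj_continuous.
Qed.
(* Cover [A] by finitely many open half-spaces [f (y i - x) < 0]. The weights are
   the negative parts of the [f0 (y i - x)], for [f0] minimising over [A] the sum
   of the squares of these negative parts. *)
Lemma exists_uniform_descent (A : set (weak_dual X)) (K : set X) x :
  A !=set0 -> compact A -> convex_set (M := weak_dual X) A ->
  convex_set (M := X) K ->
  (forall f, A f -> exists2 y, K y & pairing f (y - x) < 0) ->
  exists2 y, K y & forall f, A f -> pairing f (y - x) < 0.
Proof.
move=> A0 A_compact /convex_setP A_convex K_convex AK.
have : cover_compact A by rewrite -compact_cover.
move=> /(_ X K (fun y => [set f | pairing f (y - x) < 0]))[y _|f Af|D DK Dcov].
- apply: (@open_comp _ _ (fun f => pairing f (y - x) : R^o) [set r | r < 0]).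
    by move=> f _; exact: eval_continuous.
  exact: open_lt.
- by have [y Ky fy] := AK _ Af; exists y.
pose m := size (finmap.enum_fset D).
pose y (i : 'I_m) := nth 0 (finmap.enum_fset D) i.
pose v i := y i - x.
have yK i : K (y i).
  by have := DK _ (mem_nth 0 (ltn_ord i)); rewrite inE.
have y_cov f : A f -> exists i, pairing f (v i) < 0.
  move=> /Dcov[z /= zD fz]; have := zD; rewrite -index_mem => iz.
  by exists (Ordinal iz); rewrite /v /y /= nth_index.
pose np (r : R) := Num.max 0 (- r).
pose Phi (f : weak_dual X) : R := \sum_i np (pairing f (v i)) ^+ 2.
have Phi_cont : continuous (Phi : weak_dual X -> R^o).
  apply: (@continuous_big _ _ _ 0 xpredT add_continuous (weak_dual X)
    (index_enum 'I_m) (fun i f => np (pairing f (v i)) ^+ 2)) => i _ f.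
  have c : {for f, continuous (fun f => np (pairing f (v i)) : R^o)}.
    apply: (@continuous_comp _ _ _ (fun f => pairing f (v i) : R^o) (np : R^o -> R^o)).
      exact: eval_continuous.
    apply: continuous_max; first exact: cst_continuous.
    exact: continuousN.
  by rewrite /continuous_at expr2; exact: (cvgM c c).
have [f0 /set_mem Af0 f0_min] : exists2 f0, f0 \in A & forall f, f \in A -> Phi f0 <= Phi f.
  apply: compact_EVT_min => //; apply: continuous_subspaceT; exact: Phi_cont.
pose s i := np (pairing f0 (v i)).
have s_ge0 i : 0 <= s i by rewrite le_max lexx.
(* First-order optimality of [f0] in the direction of [f]: it gives [\sum_i s i * d i <= 0], and
   [s i * pairing f0 (v i) = - s i ^+ 2]. *)
have descent f : A f -> \sum_i s i * pairing f (v i) <= - \sum_i s i ^+ 2.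
  move=> Af; pose d i := pairing f (v i) - pairing f0 (v i).
  (* A quadratic majorant of the squared negative part, tangent at [a], replaces differentiation. *)
  have np_le (a b : R) : np (a + b) ^+ 2 <= (np a - b) ^+ 2.
    rewrite /np; case: (leP 0 (- a)) => a0; case: (leP 0 (- (a + b))) => ab0; nra.
  have quad (t : R) : 0 < t -> t <= 1 ->
      2 * \sum_i s i * d i <= t * \sum_i d i ^+ 2.
    move=> t0 t1; have Aft : A (t *: f + (1 - t) *: f0) by apply: A_convex => //; exact: ltW.
    have := f0_min _ (mem_set Aft); rewrite /Phi.
    have : \sum_i np (pairing (t *: f + (1 - t) *: f0) (v i)) ^+ 2 <=
        \sum_i (s i ^+ 2 - t * 2 * (s i * d i) + t * (t * d i ^+ 2)).
      apply: ler_sum => i _; rewrite comb_pairing.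
      rewrite (_ : _ + _ = pairing f0 (v i) + t * d i); last by rewrite /d; ring.
      apply: le_trans (np_le _ _) _; rewrite -/(s i).
      by rewrite le_eqVlt; apply/orP; left; apply/eqP; ring.
    rewrite big_split sumrB /= -!mulr_sumr.
    move: (\sum_i s i * d i) (\sum_i d i ^+ 2) => a b h1 h2.
    have := le_trans h2 h1.
    rewrite -/(s _) => h; rewrite -(ler_pM2l t0); move: h; rewrite /s; lra.
  have sd : \sum_i s i * d i <= 0.
    rewrite leNgt; apply/negP => sd0; pose b := \sum_i d i ^+ 2.
    have b0 : 0 <= b by apply: sumr_ge0 => i _; exact: sqr_ge0.
    pose a := \sum_i s i * d i; rewrite -/a in sd0.
    (* This step length gives [t * b <= a < 2 * a], and avoids dividing by [b], which may vanish. *)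
    have := quad (a / (a + b)); rewrite -/a -/b.
    rewrite divr_gt0 ?ltr_wpDr// ler_pdivrMr ?ltr_wpDr// mul1r lerDl => /(_ isT b0).
    rewrite mulrAC ler_pdivlMr ?ltr_wpDr//; nra.
  rewrite -sumrN -subr_ge0 -sumrB; apply: le_trans (_ : - \sum_i s i * d i <= _).
    by rewrite oppr_ge0.
  rewrite -sumrN; apply: ler_sum => i _; rewrite /d /s /np.
  by case: (leP 0 (- pairing f0 (v i))) => ?; nra.
have S_gt0 : 0 < \sum_i s i.
  have [i fi] := y_cov _ Af0; rewrite (bigD1 i)//= ltr_pwDl ?sumr_ge0//.
  by rewrite /s lt_max oppr_gt0 fi orbT.
have S2_gt0 : 0 < \sum_i s i ^+ 2.
  have [i fi] := y_cov _ Af0; rewrite (bigD1 i)//= ltr_pwDl ?sumr_ge0// => [|j _].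
    by rewrite exprn_gt0// /s lt_max oppr_gt0 fi orbT.
  exact: sqr_ge0.
exists (\sum_i (s i / \sum_j s j) *: y i).
  apply: convex_sum => // [i|]; first by rewrite divr_ge0// ltW.
  by rewrite -mulr_suml divff// gt_eqF.
move=> f Af; rewrite (_ : _ - x = \sum_i (s i / \sum_j s j) *: v i); last first.
  rewrite /v; under [RHS]eq_bigr do rewrite scalerBr.
  by rewrite sumrB -scaler_suml -mulr_suml divff ?scale1r// gt_eqF.
rewrite pairing_sum; under eq_bigr do rewrite pairingZ mulrAC.
rewrite -mulr_suml pmulr_llt0 ?invr_gt0//.
by rewrite (le_lt_trans (descent _ Af))// oppr_lt0.
Qed.

End WeakDual.

(** * Stability of [class_D] under open convex cuts *)

Section ClassD.
Context {R : realType} {X : normedModType R}.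

Lemma segment_closure_inter (K O : set X) (a y : X) :
  convex_set (M := X) K -> open O -> K a -> O a -> closure K y ->
  exists t : R, [/\ 0 < t, t < 1 & closure (K `&` O) (t *: y + (1 - t) *: a)].
Proof.
move=> /convex_setP K_convex O_open Ka Oa /closure_normP Ky.
have /nbhs_normP[r /= r0 rO] := open_nbhs_nbhs (conj O_open Oa).
(* The extra 1 leaves room for the points [z] of [K] approximating [y]: a single [t] then brings all
   of their combinations with [a] into the ball at [a] inside [O]. *)
pose B := `|y - a| + 1; have B0 : 0 < B by rewrite ltr_wpDl.
have rB0 : 0 < r + B by rewrite addr_gt0.
have t0 : 0 < r / (r + B) by rewrite divr_gt0.
have t1 : r / (r + B) < 1 by rewrite ltr_pdivrMr// mul1r ltrDl.
exists (r / (r + B)); split=> //; set t := r / (r + B) in t0 t1 *.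
apply/closure_normP => e e0.
have [z Kz] := Ky (Num.min e 1) (ltac:(by rewrite lt_min e0 ltr01)).
rewrite lt_min => /andP[yze yz1]; exists (t *: z + (1 - t) *: a); last first.
  rewrite opprD addrACA subrr addr0 -scalerBr normrZ gtr0_norm//.
  by rewrite (le_lt_trans _ yze)// ler_piMl// ltW.
split; first by apply: K_convex => //; exact: ltW.
apply: rO => /=; rewrite (_ : a - _ = t *: (a - z)); last first.
  by rewrite scalerBl scale1r scalerBr opprD opprB addrCA [a + _]addrC subrK addrC.
rewrite normrZ gtr0_norm// /t mulrAC ltr_pdivrMr// ltr_pM2l//.
rewrite (le_lt_trans (ler_distD y _ _))// [`|a - y|]distrC.
by rewrite ltr_pwDl// /B lerD2l ltW.
Qed.

(* The functional separating a point [z] of [closure (K `&` O)] from [O] exposes a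
   proper closed face containing [z]; and a closed face of [closure K] containing
   all of [K `&` O] is not proper, by [segment_closure_inter]. *)
Lemma class_D_inter_open (K O : set X) : class_D K -> open O ->
  convex_set (M := X) O ->
  (forall z, ~ O z -> exists g : weak_dual X, forall y, O y ->
     pairing g y < pairing g z) ->
  class_D (K `&` O).
Proof.
move=> [K_convex K_inside] O_open O_convex O_sup.
have KO_convex : convex_set (M := X) (K `&` O).
  move: K_convex O_convex => /convex_setP Kc /convex_setP Oc.
  by apply/convex_setP => x y t [Kx Ox] [Ky Oy] t0 t1; split; [exact: Kc|exact: Oc].
have clcl (A : set X) : closure (closure A) = closure A.
  by rewrite -((closure_id _).1 (@closed_closure _ _)).
split=> // z [Dz z_inside].
have {}z_inside S : face (closure (K `&` O)) S -> closed S -> S z ->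
    S = closure (K `&` O).
  move=> Sf Sc Sz; apply: contrapT => Sn; apply: z_inside; exists S => //.
  by split; rewrite ?clcl.
have Oz : O z.
  apply: contrapT => nOz; have [g gO] := O_sup _ nOz.
  have g_le y : closure (K `&` O) y -> pairing g y <= pairing g z.
    have cl : closed [set y | pairing g y <= pairing g z].
      apply: (@closed_comp _ _ (pairing g : X -> R^o) [set r | r <= pairing g z]).
        by move=> ? _; exact: pairing_continuous.
      exact: closed_le.
    rewrite [X in _ -> X](_ : _ = [set y | pairing g y <= pairing g z] y)//.
    rewrite ((closure_id _).1 cl); apply: closureS => w [_ Ow] /=.
    exact/ltW/gO.
  pose S := closure (K `&` O) `&` [set y | pairing g y = pairing g z].
  have [y [[Ky Oy] _]] := Dz setT filterT.
  suff SE : S = closure (K `&` O).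
    have : S y by rewrite SE; apply: subset_closure.
    by move=> [_ /= gyz]; have := gO _ Oy; rewrite gyz ltxx.
  apply: z_inside; last by split.
    split=> [|x [] //|x1 x2 t D1 D2 t0 t1 [_ /=]].
      apply/convex_setP => x x' t [Dx gx] [Dx' gx'] t0 t1; split.
        by have /convex_setP := convex_closure KO_convex; apply.
      by rewrite /= pairingD !pairingZ gx gx'; ring.
    rewrite pairingD !pairingZ => gt.
    have := g_le _ D1; have := g_le _ D2; rewrite /S.
    move=> g2 g1; split; (split=> //; apply/eqP; rewrite eq_le ?g1 ?g2 /=; nra).
  apply: closedI; first exact: closed_closure.
  apply: (@closed_comp _ _ (pairing g : X -> R^o) [set r | r = pairing g z]).
    by move=> ? _; exact: pairing_continuous.
  exact: closed_eq.
split=> //; apply: K_inside; split.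
  by move: Dz; apply: closureS => ? [].
move=> [F []]; rewrite clcl => -[F_convex FK F_face] F_closed Fn Fz; apply: Fn.
have [a [[Ka Oa] _]] := Dz setT filterT.
(* The trace of [F] on [closure (K]&[O)] is a closed face of it containing [z], so it is
   everything. *)
have DF : closure (K `&` O) `<=` F.
  have -> // : closure (K `&` O) = F `&` closure (K `&` O).
  apply/esym/z_inside; last by split.
    split=> [|x []//|x1 x2 t D1 D2 t0 t1 [Ft _]].
      move: F_convex (convex_closure KO_convex) => /convex_setP Fc /convex_setP Dc.
      by apply/convex_setP => x y t [Fx Dx] [Fy Dy] t0 t1; split; [exact: Fc|exact: Dc].
    have sub : closure (K `&` O) `<=` closure K by apply: closureS => ? [].
    by have [] := F_face _ _ _ (sub _ D1) (sub _ D2) t0 t1 Ft.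
  by apply: closedI => //; exact: closed_closure.
apply/seteqP; split=> // y Ky.
have [t [t0 t1 /DF Ft]] := segment_closure_inter K_convex O_open Ka Oa Ky.
by have [] := F_face _ _ _ Ky (subset_closure Ka) t0 t1 Ft.
Qed.

End ClassD.

(** * Local boundedness and the open graph of descent directions *)

Section LocallyBounded.
Context {R : realType} {X : completeNormedModType R} (C : set X)
  (T : X -> set (weak_dual X)).
Hypotheses (T_usc : usc_on C T) (T_compact : forall x, C x -> compact (T x)).

Lemma usc_onP (x : X) (W : set (weak_dual X)) : C x -> open W -> T x `<=` W ->
  exists2 d : R, 0 < d & forall z, C z -> `|z - x| < d -> T z `<=` W.
Proof.
move=> Cx W_open TW; have /nbhs_normP[d /= d0 dP] := T_usc Cx W_open TW.
by exists d => // z Cz zx; apply: dP => //=; rewrite distrC.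
Qed.

Lemma open_pairing_lt (v : X) (r : R) : open [set f : weak_dual X | pairing f v < r].
Proof.
apply: (@open_comp _ _ (fun f : weak_dual X => pairing f v : R^o) [set s | s < r]).
  by move=> f _; exact: eval_continuous.
exact: open_lt.
Qed.

Lemma pairing_bounded_above x v : C x -> exists M : R, forall f, T x f -> pairing f v < M.
Proof.
move=> Cx; have [[f0 Tf0]|T0] := pselect (T x !=set0); last first.
  by exists 0 => f Tf; case: T0; exists f.
have [f _ fmax] : exists2 f, f \in T x & forall g, g \in T x -> pairing g v <= pairing f v.
  apply: compact_EVT_max; [by exists f0|exact: T_compact|].
  by apply: continuous_subspaceT; exact: eval_continuous.
exists (pairing f v + 1) => g /mem_set/fmax gf.
by rewrite (le_lt_trans gf)// ltrDl.
Qed.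

Lemma usc_pairing_bounded x v : C x -> exists (M d : R), 0 < d /\
  forall z, C z -> `|z - x| < d -> forall f, T z f -> `|pairing f v| < M.
Proof.
move=> Cx; have [M1 M1P] := pairing_bounded_above v Cx.
have [M2 M2P] := pairing_bounded_above (- v) Cx.
have [d1 d10 d1P] := usc_onP Cx (open_pairing_lt v M1) M1P.
have [d2 d20 d2P] := usc_onP Cx (open_pairing_lt (- v) M2) M2P.
exists (Num.max M1 M2), (Num.min d1 d2); split; first by rewrite lt_min d10.
move=> z Cz; rewrite lt_min => /andP[z1 z2] f Tf.
rewrite ltr_norml lt_max (d1P _ Cz z1 _ Tf) andbT ltrNl lt_max.
by have := d2P _ Cz z2 _ Tf; rewrite /= -sub0r pairingB pairing0 sub0r => ->; rewrite orbT.
Qed.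

(** If no bound holds near [x], there are functionals at points tending to [x] whose norms are
    unbounded. They are pointwise bounded by [usc_pairing_bounded], against the uniform boundedness
    principle. *)
Lemma usc_locally_bounded x : C x -> exists (M d : R), [/\ 0 <= M, 0 < d &
  forall z, C z -> `|z - x| < d -> forall f, T z f -> forall v, `|pairing f v| <= M * `|v|].
Proof.
move=> Cx; apply: contrapT => nbd.
have bad n : exists p : X * weak_dual X * X, [/\ C p.1.1, `|p.1.1 - x| < 1 / 2 ^+ n,
    T p.1.1 p.1.2 & n%:R * `|p.2| < `|pairing p.1.2 p.2| ].
  apply: contrapT => nn; apply: nbd; exists n%:R, (1 / 2 ^+ n).
  split=> // z Cz zx f Tf v; rewrite leNgt; apply/negP => fv.
  by apply: nn; exists (z, f, v).
have [p pP] := choice bad.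
pose F : set (X -> R^o) := range (fun n => pairing (p n).1.2 : X -> R^o).
have bounded : uniform_bounded F.
  apply: Banach_Steinhauss => [_ [n _ <-]|v].
    split; last exact: pairing_linear.
    have lin := pairing_linear (p n).1.2.
    pose L := GRing.isLinear.Build R X R^o *:%R (pairing (p n).1.2) lin.
    pose f : {linear X -> R^o} := HB.pack (pairing (p n).1.2 : X -> R^o) L.
    apply/(bounded_funP f)/linear_bounded_continuous; exact: pairing_continuous.
  have [M [d [d0 dP]]] := usc_pairing_bounded v Cx.
  have [N Nd] := half_power_lt 1 d0.
  (* The sum takes care of the finitely many functionals at points not yet within [d] of [x]. *)
  exists (`|M| + \sum_(i < N) `|pairing (p i).1.2 v|) => _ [n _ <-].
  have [nN|Nn] := ltnP n N.
    rewrite (bigD1 (Ordinal nN))//= addrCA lerDl addr_ge0//.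
    by apply: sumr_ge0.
  have [Cz zx Tz _] := pP n.
  have zd : `|(p n).1.1 - x| < d.
    apply: lt_trans zx _; apply: le_lt_trans Nd.
    by rewrite !div1r lef_pV2 ?posrE ?exprn_gt0// ler_eXn2l ?ltr1n.
  rewrite (le_trans (ltW (dP _ Cz zd _ Tz)))// (le_trans (ler_norm _))// lerDl.
  by apply: sumr_ge0.
have [M MP] := bounded 1.
pose n := (Num.truncn M).+1.
have [_ _ _ pn] := pP n.
have v0 : 0 < `|(p n).2|.
  rewrite normr_gt0; apply: contraTneq pn => ->.
  by rewrite pairing0 !normr0 mulr0 ltxx.
have := MP _ (imageT _ n) (`|(p n).2|^-1 *: (p n).2).
rewrite normrZ normfV normr_id mulVf ?gt_eqF// lexx => /(_ isT).
rewrite pairingZ normrM normfV normr_id mulrC ler_pdivrMr// => pM.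
have := lt_le_trans pn pM; rewrite ltr_pM2r// ltNge.
by rewrite ltW// truncnS_gt.
Qed.

(** Write [w - z] as [y - x] plus a small vector. On [y - x] the maximum over [T x] is [- (2 * e)],
    so nearby functionals stay below [- e]; on the small vector the local bound leaves at most
    [e]. *)
Lemma descent_open_graph x y : C x -> T x !=set0 ->
  (forall f, T x f -> pairing f (y - x) < 0) ->
  exists2 d : R, 0 < d & forall z w, C z -> `|z - x| < d -> `|w - y| < d ->
    forall f, T z f -> pairing f (w - z) < 0.
Proof.
move=> Cx T0 Txy.
have [f0 /set_mem Tf0 f0max] : exists2 f, f \in T x &
    forall g, g \in T x -> pairing g (y - x) <= pairing f (y - x).
  apply: compact_EVT_max => //; first exact: T_compact.
  by apply: continuous_subspaceT; exact: eval_continuous.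
pose e := - pairing f0 (y - x) / 2.
have e0 : 0 < e by rewrite divr_gt0// oppr_gt0 Txy.
have sub : T x `<=` [set f | pairing f (y - x) < - e].
  move=> f /mem_set/f0max /le_lt_trans; apply.
  by move: (Txy _ Tf0); rewrite /e; lra.
have [d1 d10 d1P] := usc_onP Cx (open_pairing_lt _ _) sub.
have [M [d2 [M0 d20 d2P]]] := usc_locally_bounded Cx.
have M1 : 0 < 2 * (M + 1) by rewrite mulr_gt0// ltr_wpDl.
pose d3 := e / (2 * (M + 1)); have d30 : 0 < d3 by rewrite divr_gt0.
exists (Num.min d1 (Num.min d2 d3)) => [|z w Cz]; first by rewrite !lt_min d10 d20.
rewrite !lt_min => /and3P[z1 z2 z3] /and3P[_ _ w3] f Tf.
have -> : w - z = (y - x) + ((w - y) - (z - x)).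
  by rewrite [RHS]addrC opprB addrAC !subrKA.
have fe := d1P _ Cz z1 _ Tf; rewrite pairingD -ltrBrDl sub0r.
have fb := d2P _ Cz z2 _ Tf ((w - y) - (z - x)).
apply: le_lt_trans (ler_norm _) _; apply: le_lt_trans fb _.
rewrite ltrNr (lt_le_trans fe)// lerN2.
apply: (@le_trans _ _ (M * (d3 + d3))).
  by rewrite ler_wpM2l// (le_trans (ler_normB _ _))// lerD// ltW.
rewrite /d3 -mulr2n -[_ *+ 2]mulr_natl invfM.
have : e * (M / (M + 1)) <= e.
  by rewrite ler_piMr ?(ltW e0)// ler_pdivrMr ?mul1r ?lerDl// ltr_wpDl.
lra.
Qed.

End LocallyBounded.

(** * Existence of a solution *)

Lemma lsc_on_lower_sc (R : realType) (X : normedModType R) (C : set X)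
    (K : X -> set X) : lsc_on C K -> lower_sc C K.
Proof.
move=> K_lsc x Cx y xy e e0.
have [V V_open VC] := (open_subspaceP _ _).1 (K_lsc _ (@ball_open _ _ y e)).
have : (V `&` C) x by rewrite VC; split=> //; split=> //; exists y; split=> //; exact: ballxx.
move=> [Vx _]; have /nbhs_normP[d /= d0 dV] := open_nbhs_nbhs (conj V_open Vx).
exists d => // z Cz zx; have : (V `&` C) z by split=> //; apply: dV; rewrite /= distrC.
rewrite VC => -[[_ [w [zw yw]]] _]; exists w => //.
by rewrite distrC; move: yw; rewrite -ball_normE.
Qed.

Theorem theorem5 (R : realType) (X : completeNormedModType R) (C : set X)
    (K : X -> set X) (T : X -> set (weak_dual X))
    (C_nonempty : C !=set0)
    (C_convex : convex_set (M := X) C)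
    (K_into_C : forall x, C x -> K x `<=` C)
    (K_compact : compact_map C K)
    (K_lsc : lsc_on C K)
    (K_nonempty : forall x, C x -> K x !=set0)
    (K_class_D : forall x, C x -> class_D (K x))
    (fixK_closed : closed (fixpoints C K))
    (T_usc : usc_on C T)
    (T_nonempty : forall x, C x -> T x !=set0)
    (T_compact : forall x, C x -> compact (T x))
    (T_convex : forall x, C x -> convex_set (M := weak_dual X) (T x)) :
  exists x : X, exists f : weak_dual X,
    [/\ C x, K x x, T x f & forall y, K x y -> 0 <= pairing f (y - x)].
Proof.
apply: contrapT => no_solution.
have [H [H_compact HC KH]] := K_compact.
pose P x := [set y | forall f, T x f -> pairing f (y - x) < 0].
pose G x := K x `&` [set y | fixpoints C K x -> P x y].
have descent x : fixpoints C K x -> exists2 y, K x y & P x y.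
  move=> [Cx Kxx]; apply: exists_uniform_descent.
  - exact: T_nonempty.
  - exact: T_compact.
  - exact: T_convex.
  - by have [] := K_class_D x Cx.
  move=> f Tf; apply: contrapT => nf; apply: no_solution; exists x, f; split=> // y Kxy.
  by rewrite leNgt; apply/negP => fy; apply: nf; exists y.
have G_lsc : lower_sc C G.
  apply: lower_sc_restrict; first exact: lsc_on_lower_sc.
    move=> x Cx nFx; have /nbhs_normP[d /= d0 dF] :=
      open_nbhs_nbhs (conj (closed_openC fixK_closed) nFx).
    by exists d => // z _ zx; apply: dF; rewrite /= distrC.
  move=> x y Cx _ _ Pxy.
  exact: descent_open_graph T_usc T_compact _ _ Cx (T_nonempty _ Cx) Pxy.
have P_comb x y z (t : R) : P x y -> P x z -> 0 <= t -> t <= 1 ->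
    P x (t *: y + (1 - t) *: z).
  move=> xy xz t0 t1 f Tf.
  have := xy f Tf; have := xz f Tf; rewrite !pairingB pairingD !pairingZ.
  move: (pairing f x) (pairing f y) (pairing f z) => a b c ca ba.
  have -> : t * b + (1 - t) * c - a = t * (b - a) + (1 - t) * (c - a) by ring.
  have [->|tn0] := eqVneq t 0; first by rewrite mul0r add0r subr0 mul1r.
  have t_gt0 : 0 < t by rewrite lt_neqAle eq_sym tn0.
  rewrite -[ltRHS]addr0 ltr_leD ?pmulr_rlt0//.
  by rewrite mulr_ge0_le0 ?subr_ge0// ltW.
have GE x : C x -> ~ fixpoints C K x -> G x = K x.
  by move=> Cx nF; apply/seteqP; split=> [y []//|y Kxy]; split.
have GE' x : fixpoints C K x -> G x = K x `&` P x.
  by move=> Fx; apply/seteqP; split=> y [Kxy Pxy]; split=> //; exact: Pxy.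
have G_class x : C x -> class_D (G x).
  move=> Cx; have [Fx|nFx] := pselect (fixpoints C K x); last first.
    by rewrite GE//; exact: K_class_D.
  rewrite GE'//; apply: class_D_inter_open; first exact: K_class_D.
  - rewrite openE => y Pxy; apply/nbhs_normP.
    have [d d0 dP] := descent_open_graph T_usc T_compact Cx (T_nonempty _ Cx) Pxy.
    exists d => // w /= yw; apply: dP => //; first by rewrite subrr normr0.
    by rewrite distrC.
  - by apply/convex_setP => y z t; exact: P_comb.
  (* A functional of [T x] that violates the condition at [z] separates [z] strictly from [P x]. *)
  - move=> z /existsNP[f /not_implyP[Tf /negP]]; rewrite -leNgt => fz.
    exists f => y /(_ f Tf); rewrite !pairingB subr_lt0 => /lt_le_trans; apply.
    by rewrite -subr_ge0 -pairingB.
have G_nonempty x : C x -> G x !=set0.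
  move=> Cx; have [Fx|nFx] := pselect (fixpoints C K x); last first.
    by rewrite GE//; exact: K_nonempty.
  by have [y xy Pxy] := descent x Fx; exists y; split.
have GH x : C x -> G x `<=` H by move=> Cx y [xy _]; apply: KH; exists x.
have [g g_cont gG] := inside_selection C_nonempty H_compact G_lsc G_nonempty
  (fun x Cx => (G_class x Cx).1) GH.
(* Here [class_D] brings the selection from the closure of [G x] back into [G x]. *)
have {}gG x : C x -> G x (g x) by move=> Cx; apply: (G_class x Cx).2; exact: gG.
have [x Cx gx] := schauder C_convex C_nonempty H_compact HC g_cont
  (fun x Cx => GH x Cx _ (gG x Cx)).
have := gG x Cx; rewrite gx => -[Kxx /(_ (conj Cx Kxx)) Pxx].
have [f Tf] := T_nonempty x Cx.
by have := Pxx f Tf; rewrite subrr pairing0 ltxx.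
Qed.
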